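(* The Lie algebra $\mathbf g=\mathfrak{su}_3(\mathbb C,1)$ is reductive with respect to a pair $(\mathbf h,\mathbf m)$, where $\mathbf h$ is a $2$-dimensional subalgebra of $\mathbf g$ and $\mathbf m$ is a complementary subspace to $\mathbf h$ generating $\mathbf g$, if and only if, up to conjugation, one of the following holds: 1) $\mathbf h_{12}=\langle e_1,e_6\rangle$ and $\mathbf m_{12}=\langle e_2,e_3,e_4,e_5,e_7,e_8\rangle$; 2) $\mathbf h_{20}=\langle e_1-\frac12 e_6+\frac32 a(e_4-e_3)-\frac32 b(e_5+e_2)-\frac{3(a^2+b^2)}{2}(e_6+e_7),\ e_8+b(e_4-e_3)+a(e_5+e_2)+c(e_6+e_7)\rangle$ and $\mathbf m_{20}=\langle e_6+e_7,\ e_2+e_5,\ e_4-e_3,\ e_4-b e_8+2a e_1-a e_6,\ e_2+a e_8+2b e_1-b e_6,\ e_6+c e_8+b e_5-a e_4\rangle$, with $a,b,c\in\mathbb R$.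
   Context: $\mathbf g=\mathfrak{su}_3(\mathbb C,1)$ is the real Lie algebra of matrices with basis $e_1,\dots,e_8$ determined by $$\sum_{j=1}^8\lambda_j e_j=\begin{pmatrix}-\lambda_1 i&-\lambda_2-\lambda_3 i&\lambda_4+\lambda_5 i\\ \lambda_2-\lambda_3 i&\lambda_1 i+\lambda_6 i&\lambda_7+\lambda_8 i\\ \lambda_4-\lambda_5 i&\lambda_7-\lambda_8 i&-\lambda_6 i\end{pmatrix},\qquad\lambda_j\in\mathbb R,\ i^2=-1.$$ $\langle\cdots\rangle$ denotes the real linear span. $\mathbf g$ is reductive with respect to $(\mathbf h,\mathbf m)$ if $\mathbf h$ is a subalgebra, $\mathbf m$ is a subspace, $\mathbf g=\mathbf m\oplus\mathbf h$ and $[\mathbf h,\mathbf m]\subseteq\mathbf m$. ''$\mathbf m$ generates $\mathbf g$'' means generation as a Lie algebra. ''Up to conjugation'' means that the pair $(\mathbf h,\mathbf m)$ may be replaced by its image under $Ad_g$, $g\in PSU_3(\mathbb C,1)$. *)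

(* Defs.v *)
From HB Require Import structures.
From mathcomp Require Import all_boot all_order all_algebra.
From mathcomp Require Import reals.
From mathcomp Require Import complex.

Set Implicit Arguments.
Unset Strict Implicit.
Unset Printing Implicit Defensive.

Import Order.TTheory GRing.Theory Num.Theory.
Local Open Scope ring_scope.

(* The complex 3 x 3 matrices as an 18-dimensional vector space over R.  The
   type is an alias of 'M[R[i]]_3, whose library scaling is by R[i]: on
   [gl3 R] the operation [a *: A] is scaling by the real number [a], and
   {vspace gl3 R}, <<_>>%VS and \dim are taken over R. *)
Definition gl3 (R : realType) := 'M[R[i]]_3.

Section RealStructure.
Variable R : realType.

HB.instance Definition _ := GRing.Zmodule.on (gl3 R).

Definition rscale (a : R) (A : gl3 R) : gl3 R := a%:C%C *: (A : 'M[R[i]]_3).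

Fact rscaleA a b A : rscale a (rscale b A) = rscale (a * b) A.
Proof. by rewrite /rscale scalerA rmorphM. Qed.

Fact rscale1 : left_id 1 rscale.
Proof. by move=> A; rewrite /rscale rmorph1 scale1r. Qed.

Fact rscaleDr : right_distributive rscale +%R.
Proof. by move=> a A B; rewrite /rscale scalerDr. Qed.

Fact rscaleDl A : {morph rscale^~ A : a b / a + b}.
Proof. by move=> a b; rewrite /rscale rmorphD scalerDl. Qed.

HB.instance Definition _ := GRing.Zmodule_isLmodule.Build R (gl3 R)
  rscaleA rscale1 rscaleDr rscaleDl.

Lemma gl3_scaleE (a : R) (A : gl3 R) :
  a *: A = a%:C%C *: (A : 'M[R[i]]_3) :> 'M[R[i]]_3.
Proof. by []. Qed.

Lemma gl3_scaleEij (a : R) (A : gl3 R) i j : (a *: A) i j = a%:C%C * A i j.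
Proof. by rewrite gl3_scaleE mxE. Qed.

Definition gl3_row (A : gl3 R) : 'rV[R]_(3 * 3 + 3 * 3) :=
  row_mx (mxvec (\matrix_(i < 3, j < 3) complex.Re (A i j)))
         (mxvec (\matrix_(i < 3, j < 3) complex.Im (A i j))).

Definition row_gl3 (v : 'rV[R]_(3 * 3 + 3 * 3)) : gl3 R :=
  \matrix_(i < 3, j < 3)
    (vec_mx (lsubmx v) i j +i* vec_mx (rsubmx v) i j)%C.

Fact gl3_vect_iso : Vector.axiom (3 * 3 + 3 * 3) (gl3 R).
Proof.
exists gl3_row.
  move=> a A B; rewrite /gl3_row scale_row_mx add_row_mx -!linearZ -!linearD /=.
  congr (row_mx (mxvec _) (mxvec _)); apply/matrixP=> i j; rewrite !mxE /=.
    by case: (A i j) (B i j) => [x y] [z t] /=; rewrite mul0r subr0.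
  by case: (A i j) (B i j) => [x y] [z t] /=; rewrite mul0r addr0.
exists row_gl3 => [A | v].
  apply/matrixP=> i j; rewrite /row_gl3 /gl3_row row_mxKl row_mxKr !mxvecK !mxE.
  by case: (A i j).
rewrite -[RHS]hsubmxK /gl3_row; congr row_mx.
  by rewrite -[RHS]vec_mxK; congr mxvec; apply/matrixP=> i j; rewrite !mxE.
by rewrite -[RHS]vec_mxK; congr mxvec; apply/matrixP=> i j; rewrite !mxE.
Qed.

HB.instance Definition _ := Lmodule_hasFinDim.Build R (gl3 R) gl3_vect_iso.

End RealStructure.

Section LieNotions.
Variable R : realType.
Implicit Types (A B : gl3 R) (U g h m : {vspace gl3 R}).

Definition lie A B : gl3 R := A *m B - B *m A.

Definition lie_closed U := forall A B, A \in U -> B \in U -> lie A B \in U.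

Definition subalgebra g h := (h <= g)%VS /\ lie_closed h.

Definition complementary g m h := (m + h)%VS = g /\ directv (m + h).

Definition reductive g h m :=
  [/\ subalgebra g h,
      complementary g m h
    & forall A B, A \in h -> B \in m -> lie A B \in m].

Definition generates g m :=
  (m <= g)%VS /\ forall U, subalgebra g U -> (m <= U)%VS -> U = g.

End LieNotions.

Section SU.
Variable R : realType.

Definition su_mx (l1 l2 l3 l4 l5 l6 l7 l8 : R) : gl3 R :=
  \matrix_(i < 3, j < 3) nth 0 (nth [::]
    [:: [:: 0 +i* (- l1);    (- l2) +i* (- l3); l4 +i* l5  ];
        [:: l2 +i* (- l3);   0 +i* (l1 + l6);   l7 +i* l8  ];
        [:: l4 +i* (- l5);   l7 +i* (- l8);     0 +i* (- l6)]]%C i) j.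

(* e_1, ..., e_8; junk value 0 for the other indices *)
Definition e (k : nat) : gl3 R :=
  let d j : R := (k == j)%:R in
  su_mx (d 1) (d 2) (d 3) (d 4) (d 5) (d 6) (d 7) (d 8).

Lemma su_mxZ a l1 l2 l3 l4 l5 l6 l7 l8 :
  a *: su_mx l1 l2 l3 l4 l5 l6 l7 l8 =
  su_mx (a * l1) (a * l2) (a * l3) (a * l4) (a * l5) (a * l6) (a * l7) (a * l8).
Proof.
have sc (x y : R) : a%:C%C * (x +i* y)%C = ((a * x)%R +i* (a * y)%R)%C.
  by apply/eqP; rewrite eq_complex /= !mul0r subr0 addr0 !eqxx.
apply/matrixP=> i j; rewrite gl3_scaleEij [X in _ * X]mxE [RHS]mxE.
case: i => [[|[|[|i]]] ?]; last by [].
all: (case: j => [[|[|[|j]]] ?]; last by []).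
all: by rewrite /= sc ?mulr0 ?mulrN ?mulrDr.
Qed.

Lemma su_mxD l1 l2 l3 l4 l5 l6 l7 l8 k1 k2 k3 k4 k5 k6 k7 k8 :
  su_mx l1 l2 l3 l4 l5 l6 l7 l8 + su_mx k1 k2 k3 k4 k5 k6 k7 k8 =
  su_mx (l1 + k1) (l2 + k2) (l3 + k3) (l4 + k4)
        (l5 + k5) (l6 + k6) (l7 + k7) (l8 + k8).
Proof.
have ad (x y z t : R) : (x +i* y)%C + (z +i* t)%C = ((x + z)%R +i* (y + t)%R)%C.
  by [].
apply/matrixP=> i j; rewrite [LHS]mxE [X in X + _]mxE [X in _ + X]mxE [RHS]mxE.
case: i => [[|[|[|i]]] ?]; last by [].
all: (case: j => [[|[|[|j]]] ?]; last by []).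
all: by rewrite /= ad ?addr0 ?opprD // addrACA.
Qed.

Lemma sum_e (l : nat -> R) :
  \sum_(1 <= k < 9) l k *: e k =
  su_mx (l 1) (l 2) (l 3) (l 4) (l 5) (l 6) (l 7) (l 8).
Proof.
rewrite (_ : index_iota 1 9 = [:: 1; 2; 3; 4; 5; 6; 7; 8])%N //.
rewrite !big_cons big_nil addr0 /e !su_mxZ !su_mxD.
by congr su_mx; rewrite /= ?mulr0 ?mulr1 ?addr0 ?add0r.
Qed.

Definition su : {vspace gl3 R} := <<[seq e k | k <- iota 1 8]%R>>%VS.

(* The Hermitian form preserved by SU_3(C,1): su consists of the trace-zero
   X with X^* J + J X = 0. *)
Definition J : 'M[R[i]]_3 := diag_mx (\row_j (if j == ord_max then -1 else 1)).

Definition SU (g : 'M[R[i]]_3) : Prop :=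
  (map_mx conjc g)^T *m J *m g = J /\ \det g = 1.

Definition Ad (g : 'M[R[i]]_3) (X : gl3 R) : gl3 R := g *m X *m invmx g.

Fact Ad_linear g : linear (Ad g).
Proof.
move=> a X Y; rewrite /Ad gl3_scaleE mulmxDr mulmxDl -scalemxAr.
by rewrite -scalemxAl.
Qed.

HB.instance Definition _ g :=
  GRing.isLinear.Build R (gl3 R) (gl3 R) *:%R (Ad g) (Ad_linear g).

(* The pair (h', m') is the image of (h, m) under Ad_g for some g in
   PSU_3(C,1), the quotient of SU by its center: central elements are scalar
   matrices and act trivially, so g is taken in SU. *)
Definition conjugate_pair (h m h' m' : {vspace gl3 R}) : Prop :=
  exists g, [/\ SU g,
    (linfun (Ad g) @: h)%VS = h' & (linfun (Ad g) @: m)%VS = m'].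

Definition h12 : {vspace gl3 R} := <<[:: e 1; e 6]%R>>%VS.

Definition m12 : {vspace gl3 R} := <<[:: e 2; e 3; e 4; e 5; e 7; e 8]%R>>%VS.

Definition h20 (a b c : R) : {vspace gl3 R} :=
  <<[:: e 1 - (1 / 2) *: e 6 + (3 / 2 * a) *: (e 4 - e 3)
          - (3 / 2 * b) *: (e 5 + e 2)
          - (3 * (a ^+ 2 + b ^+ 2) / 2) *: (e 6 + e 7);
        e 8 + b *: (e 4 - e 3) + a *: (e 5 + e 2) + c *: (e 6 + e 7)]%R>>%VS.

Definition m20 (a b c : R) : {vspace gl3 R} :=
  <<[:: e 6 + e 7;
        e 2 + e 5;
        e 4 - e 3;
        e 4 - b *: e 8 + (2 * a) *: e 1 - a *: e 6;
        e 2 + a *: e 8 + (2 * b) *: e 1 - b *: e 6;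
        e 6 + c *: e 8 + b *: e 5 - a *: e 4]%R>>%VS.

End SU.

(* Main.v *)
Require Import Defs.
From mathcomp Require Import all_boot all_order all_algebra.
From mathcomp Require Import reals.
From mathcomp Require Import complex.
From mathcomp Require Import perm.
From mathcomp Require Import ring lra spectral.

(** Call (h, m) admissible when it satisfies the left-hand side. The theorem holds
because h must be a Cartan subalgebra, because su(2,1) has exactly two conjugacy
classes of Cartan subalgebras, and because the complement of a Cartan subalgebra h
is determined: it contains [[h, g]], the sum of the root spaces, which already has
codimension 2.

No nilpotent element. If Y in h is nilpotent, then Jacobson-Morozov gives F in g
with [[Y, [Y, F]] = Y]. When (ad Y)^2 kills h, replacing F by its m-component
shows that Y lies in m, so Y = 0 ([reductive_no_nilpotent]). This excludes the
nonabelian plane, whose derived algebra is spanned by a nilpotent Y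
([reductive_abelian]).

A regular element. Now h is commutative, so it can be triangularised over the
complex numbers, and the diagonal entries are three weights on h that add up to
zero. Two weights that coincide take imaginary values, since the spectrum of an
element of g is stable under [z |-> - z^*]; then they have a common zero on the
real plane h, which is a nilpotent element. So the weights are distinct, and some X
in h has three distinct eigenvalues ([regular_element]).

Two conjugacy classes. Eigenvectors of X for eigenvalues a and b are orthogonal for
the Hermitian form unless [a + b^* = 0]. Since the signature is (2, 1), an
eigenbasis of X is, up to order and scaling, either orthogonal with one negative
vector, or made of a positive vector and a hyperbolic pair ([gram_normal_form]).
Rescaling gives an element of SU that carries h into [h12] or into [h20 0 0 0]
([diagonal_form], [classification]); dimensions give equality.

Conversely, the pairs (h12, m12) and (h20 0 0 0, m20 0 0 0) are admissible by a
direct computation, admissibility is invariant under Ad, and a unipotent element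
of SU carries [h20 0 0 0] to [h20 a b c]. It also carries the complements to each
other, because [m20 a b c] is the orthogonal of [h20 a b c] for the invariant form
[tr (X Y)] ([h20_conjugate]). *)

Set Implicit Arguments.
Unset Strict Implicit.
Unset Printing Implicit Defensive.

Import Order.TTheory GRing.Theory Num.Theory.
Local Open Scope ring_scope.

(** * Three by three matrices by entries *)

Lemma complex_ext (R : realType) (x y : R[i]) :
  complex.Re x = complex.Re y -> complex.Im x = complex.Im y -> x = y.
Proof. by case: x => a b; case: y => c d /= -> ->. Qed.

Definition o0 : 'I_3 := ord0.
Definition o1 : 'I_3 := @Ordinal 3 1 isT.
Definition o2 : 'I_3 := ord_max.

Lemma ord3P (i : 'I_3) : [\/ i = o0, i = o1 | i = o2].
Proof.
case: i => [[|[|[|//]]] lti]; [apply: Or31|apply: Or32|apply: Or33]; exact: val_inj.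
Qed.

Lemma sum3 (V : nmodType) (F : 'I_3 -> V) : \sum_i F i = F o0 + F o1 + F o2.
Proof.
rewrite !big_ord_recr big_ord0 /= add0r.
by congr (F _ + F _ + F _); apply: val_inj.
Qed.

Section Mx3.
Variable F : comNzRingType.
Implicit Types A B : 'M[F]_3.

(** The row-list encoding makes [su_mx] an instance of [mx3] by conversion. *)
Definition mx3 (a b c d e f g h k : F) : 'M[F]_3 :=
  \matrix_(i < 3, j < 3)
    nth 0 (nth [::] [:: [:: a; b; c]; [:: d; e; f]; [:: g; h; k]] i) j.

Lemma mx3_eta A :
  A = mx3 (A o0 o0) (A o0 o1) (A o0 o2) (A o1 o0) (A o1 o1) (A o1 o2)
          (A o2 o0) (A o2 o1) (A o2 o2).
Proof.
apply/matrixP=> i j; rewrite mxE.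
by case: (ord3P i) => ->; case: (ord3P j) => ->.
Qed.

Lemma mx3M a b c d e f g h k a' b' c' d' e' f' g' h' k' :
  mx3 a b c d e f g h k *m mx3 a' b' c' d' e' f' g' h' k' =
  mx3 (a * a' + b * d' + c * g') (a * b' + b * e' + c * h')
      (a * c' + b * f' + c * k')
      (d * a' + e * d' + f * g') (d * b' + e * e' + f * h')
      (d * c' + e * f' + f * k')
      (g * a' + h * d' + k * g') (g * b' + h * e' + k * h')
      (g * c' + h * f' + k * k').
Proof.
apply/matrixP=> i j; rewrite !mxE sum3 !mxE.
by case: (ord3P i) => ->; case: (ord3P j) => ->.
Qed.

Lemma mx3D a b c d e f g h k a' b' c' d' e' f' g' h' k' :
  mx3 a b c d e f g h k + mx3 a' b' c' d' e' f' g' h' k' =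
  mx3 (a + a') (b + b') (c + c') (d + d') (e + e') (f + f')
      (g + g') (h + h') (k + k').
Proof.
apply/matrixP=> i j; rewrite !mxE.
by case: (ord3P i) => ->; case: (ord3P j) => ->.
Qed.

Lemma mx3N a b c d e f g h k :
  - mx3 a b c d e f g h k =
  mx3 (- a) (- b) (- c) (- d) (- e) (- f) (- g) (- h) (- k).
Proof.
apply/matrixP=> i j; rewrite !mxE.
by case: (ord3P i) => ->; case: (ord3P j) => ->.
Qed.

Lemma mx3_diag (d : 'rV[F]_3) :
  diag_mx d = mx3 (d 0 o0) 0 0 0 (d 0 o1) 0 0 0 (d 0 o2).
Proof.
apply/matrixP=> i j; rewrite !mxE.
by case: (ord3P i) => ->; case: (ord3P j) => ->.
Qed.

Lemma mx3_scalar (x : F) : x%:M = mx3 x 0 0 0 x 0 0 0 x.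
Proof.
apply/matrixP=> i j; rewrite !mxE.
by case: (ord3P i) => ->; case: (ord3P j) => ->.
Qed.

Lemma mx3_0 : 0 = mx3 0 0 0 0 0 0 0 0 0.
Proof.
apply/matrixP=> i j; rewrite !mxE.
by case: (ord3P i) => ->; case: (ord3P j) => ->.
Qed.

Lemma mx3_tr a b c d e f g h k : \tr (mx3 a b c d e f g h k) = a + e + k.
Proof. by rewrite /mxtrace sum3 !mxE. Qed.

Lemma mx3_inj a b c d e f g h k a' b' c' d' e' f' g' h' k' :
  mx3 a b c d e f g h k = mx3 a' b' c' d' e' f' g' h' k' ->
  [/\ a = a', b = b' & c = c'] /\ [/\ d = d', e = e' & f = f'] /\
  [/\ g = g', h = h' & k = k'].
Proof.
move=> /matrixP E.
have := (E o0 o0, E o0 o1, E o0 o2, E o1 o0, E o1 o1, E o1 o2, E o2 o0,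
         E o2 o1, E o2 o2).
by rewrite !mxE /=; do 8![case]; do !split.
Qed.

Lemma mx3_det a b c d e f g h k :
  \det (mx3 a b c d e f g h k) =
  a * (e * k - f * h) - b * (d * k - f * g) + c * (d * h - e * g).
Proof.
rewrite (expand_det_row _ o0) sum3 /cofactor !(expand_det_row _ ord0).
rewrite !big_ord_recr !big_ord0 /= /cofactor !det_mx11 !mxE /=.
rewrite /bump /= !expr0 !expr1 ?add0r.
ring.
Qed.

End Mx3.

(** * The algebra su in coordinates and by its Hermitian form *)

Section Coordinates.
Variable R : realType.
Notation C := R[i].
Implicit Types (A B X Y : gl3 R) (V : {vspace gl3 R}).

Definition star (A : 'M[C]_3) : 'M[C]_3 := (map_mx conjc A)^T.

Lemma starK : involutive star.
Proof. by move=> A; apply/matrixP=> i j; rewrite !mxE conjcK. Qed.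

Lemma starM (A B : 'M[C]_3) : star (A *m B) = star B *m star A.
Proof. by rewrite /star map_mxM trmx_mul. Qed.

Lemma starD (A B : 'M[C]_3) : star (A + B) = star A + star B.
Proof. by rewrite /star map_mxD linearD. Qed.

Lemma starN (A : 'M[C]_3) : star (- A) = - star A.
Proof. by rewrite /star map_mxN linearN. Qed.

Lemma star_real (a : R) (A : 'M[C]_3) : star (a%:C%C *: A) = a%:C%C *: star A.
Proof.
by apply/matrixP=> i j; rewrite !mxE rmorphM; congr (_ * _); apply: conjc_real.
Qed.

Lemma star1 : star 1%:M = 1%:M.
Proof. by rewrite /star map_mx1 trmx1. Qed.

Lemma tr_star (A : 'M[C]_3) : \tr (star A) = ((\tr A)^*)%C.
Proof.
by rewrite mxtrace_tr /mxtrace raddf_sum; apply: eq_bigr => i _; rewrite mxE.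
Qed.

Lemma det_star (A : 'M[C]_3) : \det (star A) = ((\det A)^*)%C.
Proof. by rewrite det_tr det_map_mx. Qed.

Lemma mx3_star (a b c d e f g h k : C) :
  star (mx3 a b c d e f g h k) =
  mx3 (a^*)%C (d^*)%C (g^*)%C (b^*)%C (e^*)%C (h^*)%C (c^*)%C (f^*)%C (k^*)%C.
Proof.
apply/matrixP=> i j; rewrite !mxE.
by case: (ord3P i) => ->; case: (ord3P j) => ->.
Qed.

Lemma mx3_J : J R = mx3 1 0 0 0 1 0 0 0 (-1).
Proof. by rewrite /J mx3_diag !mxE. Qed.

Lemma JJ : J R *m J R = 1%:M.
Proof. by rewrite mx3_J mx3M mx3_scalar; congr mx3; ring. Qed.

Lemma star_J : star (J R) = J R.
Proof.
by rewrite mx3_J mx3_star; congr mx3; apply: complex_ext; rewrite /= ?oppr0.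
Qed.

Lemma su_mxE (l1 l2 l3 l4 l5 l6 l7 l8 : R) :
  su_mx l1 l2 l3 l4 l5 l6 l7 l8 =
  mx3 (0 +i* (- l1))%C    ((- l2) +i* (- l3))%C (l4 +i* l5)%C
      (l2 +i* (- l3))%C   (0 +i* (l1 + l6))%C   (l7 +i* l8)%C
      (l4 +i* (- l5))%C   (l7 +i* (- l8))%C     (0 +i* (- l6))%C.
Proof. by []. Qed.

Lemma su_mxN l1 l2 l3 l4 l5 l6 l7 l8 :
  - su_mx l1 l2 l3 l4 l5 l6 l7 l8 =
  su_mx (- l1) (- l2) (- l3) (- l4) (- l5) (- l6) (- l7) (- l8) :> gl3 R.
Proof. by rewrite -scaleN1r su_mxZ !mulN1r. Qed.

Definition su_mxG := (su_mxZ, su_mxN, su_mxD).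

Lemma su_mx_inj l1 l2 l3 l4 l5 l6 l7 l8 k1 k2 k3 k4 k5 k6 k7 k8 :
  su_mx l1 l2 l3 l4 l5 l6 l7 l8 = su_mx k1 k2 k3 k4 k5 k6 k7 k8 :> gl3 R ->
  [/\ l1 = k1, l2 = k2, l3 = k3 & l4 = k4] /\
  [/\ l5 = k5, l6 = k6, l7 = k7 & l8 = k8].
Proof.
rewrite !su_mxE => /mx3_inj[] [[/oppr_inj E1] _ [E4 E5]] [] [[E2 /oppr_inj E3]].
by move=> _ [E7 E8] [_ _ [/oppr_inj E6]].
Qed.

Lemma mem_span_cons (x : gl3 R) s X :
  X \in <<x :: s>>%VS <-> exists k : R, X - k *: x \in <<s>>%VS.
Proof.
rewrite span_cons; split=> [/memv_addP[_ /vlineP[k ->] [y ys ->]] | [k Xs]].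
  by exists k; rewrite addrC addKr.
by rewrite -(subrK (k *: x) X) addrC memv_add // memvZ // memv_line.
Qed.

Lemma suP X :
  X \in su R <-> exists l1 l2 l3 l4 l5 l6 l7 l8 : R,
    X = su_mx l1 l2 l3 l4 l5 l6 l7 l8.
Proof.
split=> [|[l1 [l2 [l3 [l4 [l5 [l6 [l7 [l8 ->]]]]]]]]].
  rewrite /su /=; do 8![case/mem_span_cons=> ?].
  rewrite span_nil memv0 subr_eq0 !subr_eq => /eqP ->.
  by rewrite /e !su_mxG; do 8!eexists.
pose l k := nth 0 [:: 0; l1; l2; l3; l4; l5; l6; l7; l8] k.
rewrite -[su_mx _ _ _ _ _ _ _ _](sum_e l) big_nat.
apply: memv_suml => k k19; apply: memvZ; apply: memv_span.
by apply: map_f; rewrite mem_iota.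
Qed.

(** The Lie algebra of the group of the form [J] inside the traceless matrices. *)
Definition skew (X : 'M[C]_3) := star X *m J R + J R *m X = 0 /\ \tr X = 0.

Lemma suE X : X \in su R <-> skew X.
Proof.
split=> [/suP[l1 [l2 [l3 [l4 [l5 [l6 [l7 [l8 ->]]]]]]]] | ].
  split; last by rewrite su_mxE mx3_tr; apply: complex_ext => /=; ring.
  rewrite su_mxE mx3_star mx3_J !mx3M mx3D mx3_0.
  by congr mx3; apply: complex_ext => /=; ring.
rewrite [X]mx3_eta; move: (X o0 o0) (X o0 o1) (X o0 o2) (X o1 o0) (X o1 o1).
move: (X o1 o2) (X o2 o0) (X o2 o1) (X o2 o2) => {X}.
move=> [f1 f2] [g1 g2] [h1 h2] [k1 k2] [a1 a2] [b1 b2] [c1 c2] [d1 d2] [e1 e2].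
rewrite /skew mx3_star mx3_J !mx3M mx3D mx3_tr [X in _ = X]mx3_0.
case=> /mx3_inj[[E00 E01 E02] [[E10 E11 E12] [E20 E21 E22]]] E.
move: E00 E01 E02 E10 E11 E12 E20 E21 E22 E.
do 10![move/eqP; rewrite eq_complex /= => /andP[/eqP ? /eqP ?]].
apply/suP; exists (- a2), d1, (- d2), c1, c2, (- k2), f1, f2; rewrite su_mxE.
by congr mx3; apply: complex_ext => /=; lra.
Qed.
End Coordinates.

(** * The trace form and the model subspaces *)

Section Models.
Variable R : realType.
Implicit Types (A B X Y : gl3 R) (U V : {vspace gl3 R}).

(** The structure constants of su in the basis [e]; every explicit bracket
    below is read off from this table. *)
Lemma lie_su (l1 l2 l3 l4 l5 l6 l7 l8 k1 k2 k3 k4 k5 k6 k7 k8 : R) :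
  lie (su_mx l1 l2 l3 l4 l5 l6 l7 l8) (su_mx k1 k2 k3 k4 k5 k6 k7 k8) =
  su_mx
    (2 * (l4 * k5 - l5 * k4) - 2 * (l2 * k3 - l3 * k2))
    (2 * (l1 * k3 - l3 * k1) - (l3 * k6 - l6 * k3) - (l4 * k7 - l7 * k4)
       - (l5 * k8 - l8 * k5))
    ((l2 * k6 - l6 * k2) - 2 * (l1 * k2 - l2 * k1) + (l4 * k8 - l8 * k4)
       - (l5 * k7 - l7 * k5))
    ((l1 * k5 - l5 * k1) - (l2 * k7 - l7 * k2) + (l3 * k8 - l8 * k3)
       + (l5 * k6 - l6 * k5))
    (- (l1 * k4 - l4 * k1) - (l2 * k8 - l8 * k2) - (l3 * k7 - l7 * k3)
       - (l4 * k6 - l6 * k4))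
    (- 2 * (l4 * k5 - l5 * k4) - 2 * (l7 * k8 - l8 * k7))
    ((l2 * k4 - l4 * k2) - (l1 * k8 - l8 * k1) + (l3 * k5 - l5 * k3)
       - 2 * (l6 * k8 - l8 * k6))
    ((l1 * k7 - l7 * k1) + (l2 * k5 - l5 * k2) - (l3 * k4 - l4 * k3)
       + 2 * (l6 * k7 - l7 * k6)).
Proof.
rewrite /lie !su_mxE !mx3M mx3N mx3D.
by congr mx3; apply: complex_ext => /=; ring.
Qed.

Lemma tr_su (l1 l2 l3 l4 l5 l6 l7 l8 k1 k2 k3 k4 k5 k6 k7 k8 : R) :
  \tr (su_mx l1 l2 l3 l4 l5 l6 l7 l8 *m su_mx k1 k2 k3 k4 k5 k6 k7 k8) =
  (2 * (l4 * k4 + l5 * k5 + l7 * k7 + l8 * k8 - l2 * k2 - l3 * k3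
         - l1 * k1 - l6 * k6) - l1 * k6 - l6 * k1)%:C%C.
Proof.
rewrite !su_mxE mx3M mx3_tr.
by apply: complex_ext => /=; ring.
Qed.

Lemma h12P X : X \in h12 R <-> exists s t, X = su_mx s 0 0 0 0 t 0 0.
Proof.
split=> [|[s [t ->]]].
  rewrite /h12; do 2![case/mem_span_cons=> ?].
  rewrite span_nil memv0 subr_eq0 !subr_eq => /eqP ->.
  by rewrite /e !su_mxG; do 2!eexists; congr su_mx; rewrite /=; ring.
rewrite /h12; apply/mem_span_cons; exists s; apply/mem_span_cons; exists t.
rewrite span_nil memv0 subr_eq0 !subr_eq /e !su_mxG /=.
by apply/eqP; congr su_mx; ring.
Qed.

Lemma m12P X : X \in m12 R <->
  exists l2 l3 l4 l5 l7 l8, X = su_mx 0 l2 l3 l4 l5 0 l7 l8.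
Proof.
split=> [|[l2 [l3 [l4 [l5 [l7 [l8 ->]]]]]]].
  rewrite /m12; do 6![case/mem_span_cons=> ?].
  rewrite span_nil memv0 subr_eq0 !subr_eq => /eqP ->.
  by rewrite /e !su_mxG; do 6!eexists; congr su_mx; rewrite /=; ring.
rewrite /m12; apply/mem_span_cons; exists l2; apply/mem_span_cons; exists l3.
apply/mem_span_cons; exists l4; apply/mem_span_cons; exists l5.
apply/mem_span_cons; exists l7; apply/mem_span_cons; exists l8.
rewrite span_nil memv0 subr_eq0 !subr_eq /e !su_mxG /=.
by apply/eqP; congr su_mx; ring.
Qed.

Lemma h20P (a b c : R) X : X \in h20 a b c <->
  exists s t, X = su_mx s (a * t - 3 / 2 * b * s) (- b * t - 3 / 2 * a * s)
    (b * t + 3 / 2 * a * s) (a * t - 3 / 2 * b * s)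
    (c * t - (1 / 2 + 3 / 2 * (a ^+ 2 + b ^+ 2)) * s)
    (c * t - 3 / 2 * (a ^+ 2 + b ^+ 2) * s) t.
Proof.
split=> [|[s [t ->]]].
  rewrite /h20; case/mem_span_cons=> s; case/mem_span_cons=> t.
  rewrite span_nil memv0 subr_eq0 !subr_eq => /eqP ->; exists s, t.
  by rewrite /e !su_mxG; congr su_mx; rewrite /=; field.
rewrite /h20; apply/mem_span_cons; exists s; apply/mem_span_cons; exists t.
rewrite span_nil memv0 subr_eq0 !subr_eq /e !su_mxG /=.
by apply/eqP; congr su_mx; field.
Qed.

(** [x4], [x5] and [x6] are the coefficients of the last three spanning vectors
    of [m20]; the other three are then forced, which leaves two equations. *)
Lemma m20P (a b c l1 l2 l3 l4 l5 l6 l7 l8 : R) :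
  let x6 := l6 - l7 + l1 / 2 in
  let x5 := l2 - l5 + b * x6 in
  let x4 := l4 + l3 + a * x6 in
  su_mx l1 l2 l3 l4 l5 l6 l7 l8 \in m20 a b c <->
  l1 = 2 * a * x4 + 2 * b * x5 /\ l8 = a * x5 - b * x4 + c * x6.
Proof.
move=> x6 x5 x4; split.
  rewrite /m20; do 6![case/mem_span_cons=> ?].
  rewrite span_nil memv0 subr_eq0 !subr_eq /e !su_mxG /= => /eqP.
  rewrite /x5 /x4 /x6 {x6 x5 x4} => /su_mx_inj[[-> -> -> ->] [-> -> -> ->]].
  by split; field.
move=> [E1 E8].
have E2 : l2 = x5 + l5 - b * x6 by rewrite /x5; ring.
have E4 : l4 = x4 - l3 - a * x6 by rewrite /x4; ring.
have E6 : l6 = x6 + l7 - l1 / 2 by rewrite /x6; ring.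
clearbody x4 x5 x6; rewrite /m20; apply/mem_span_cons; exists l7.
apply/mem_span_cons; exists (l5 - b * x6).
apply/mem_span_cons; exists (- l3); apply/mem_span_cons; exists x4.
apply/mem_span_cons; exists x5; apply/mem_span_cons; exists x6.
rewrite span_nil memv0 subr_eq0 !subr_eq /e !su_mxG /=; apply/eqP.
by congr su_mx; rewrite ?E8 ?E6 ?E4 ?E2 ?E1; field.
Qed.

(** The trace form is a multiple of the Killing form, and it is invariant under
    [Ad]; this lets a complement be carried along with its subalgebra. *)
Definition trace_orthogonal V (X : gl3 R) :=
  X \in su R /\ forall H, H \in V -> \tr (X *m H) = 0.

(** The reductive complement of a Cartan subalgebra is the sum of its root
    spaces, which is its orthogonal for the Killing form. *)
Lemma m20_trace_orthogonal (a b c : R) X :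
  X \in m20 a b c <-> trace_orthogonal (h20 a b c) X.
Proof.
split=> [Xm|[/suP[l1 [l2 [l3 [l4 [l5 [l6 [l7 [l8 ->]]]]]]]] X0]].
  have Xsu : X \in su R.
    apply: subvP Xm; apply/span_subvP=> Y; rewrite !inE.
    by do 6?[case/orP]; move=> /eqP->; rewrite /e !su_mxG; apply/suP; do 8!eexists.
  split=> // H /h20P[s [t ->]].
  move: Xsu Xm => /suP[l1 [l2 [l3 [l4 [l5 [l6 [l7 [l8 ->]]]]]]]] /m20P[E1 E8].
  rewrite tr_su E8; congr (_ %:C)%C.
  set x6 := _ + l1 / 2 in E1 E8 *; move: E1 E8.
  set x4 := _ + a * x6; set x5 := _ + b * x6 => E1 E8.
  have E2 : l2 = x5 + l5 - b * x6 by rewrite /x5; ring.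
  have E4 : l4 = x4 - l3 - a * x6 by rewrite /x4; ring.
  have E6 : l6 = x6 + l7 - l1 / 2 by rewrite /x6; ring.
  by clearbody x4 x5 x6; rewrite E6 E4 E2 E1; field.
have /X0 : su_mx 1 (- (3 / 2 * b)) (- (3 / 2 * a)) (3 / 2 * a) (- (3 / 2 * b))
    (- (1 / 2 + 3 / 2 * (a ^+ 2 + b ^+ 2)))
    (- (3 / 2 * (a ^+ 2 + b ^+ 2))) 0 \in h20 a b c.
  by apply/h20P; exists 1, 0; congr su_mx; ring.
have /X0 : su_mx 0 a (- b) b a c c 1 \in h20 a b c.
  by apply/h20P; exists 0, 1; congr su_mx; ring.
rewrite !tr_su => -[E2] [E1]; apply/m20P.
have E8 : l8 = a * (l2 - l5) - b * (l4 + l3) + c * (l6 - l7 + l1 / 2).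
  by lra.
split; last by rewrite E8; ring.
lra.
Qed.

End Models.

(** * The two model pairs at the origin *)

Section Converse.
Variable R : realType.
Notation C := R[i].
Implicit Types (A B X Y : gl3 R) (U V h m : {vspace gl3 R}).

Definition admissible h m :=
  [/\ reductive (su R) h m, \dim h = 2%N & generates (su R) m].

Lemma lieDl A B X : lie (A + B) X = lie A X + lie B X.
Proof. by rewrite /lie mulmxDl mulmxDr opprD addrACA. Qed.

Lemma lieZl (a : R) A X : lie (a *: A) X = a *: lie A X.
Proof. by rewrite /lie !gl3_scaleE -scalemxAl -scalemxAr -scalerBr. Qed.

Lemma lieC A B : lie B A = - lie A B.
Proof. by rewrite /lie opprB. Qed.

Lemma lieDr A B X : lie X (A + B) = lie X A + lie X B.
Proof. by rewrite !(lieC _ X) lieDl opprD. Qed.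

Lemma lieZr (a : R) A X : lie X (a *: A) = a *: lie X A.
Proof. by rewrite !(lieC _ X) lieZl scalerN. Qed.

Lemma su_le U :
  (forall k, (0 < k < 9)%N -> e R k \in U) -> (su R <= U)%VS.
Proof.
move=> eU; apply/span_subvP=> X /mapP[k]; rewrite mem_iota => k19 ->.
exact: eU.
Qed.

Lemma e1_bracket : e R 1 = (- 1 / 2) *: lie (e R 2) (e R 3).
Proof. by rewrite /e lie_su su_mxZ; congr su_mx; rewrite /=; field. Qed.
Lemma e6_bracket : e R 6 = (- 1 / 2) *: lie (e R 7) (e R 8).
Proof. by rewrite /e lie_su su_mxZ; congr su_mx; rewrite /=; field. Qed.
Lemma e8_bracket : e R 8 = lie (e R 2) (e R 5).
Proof. by rewrite /e lie_su; congr su_mx; rewrite /=; field. Qed.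

Lemma m12_generates : generates (su R) (m12 R).
Proof.
split=> [|U [sU lU] mU].
  by apply/subvP=> X /m12P[? [? [? [? [? [? ->]]]]]]; apply/suP; do 8!eexists.
apply/eqP; rewrite eqEsubv sU; apply: su_le.
have eU k : k \in [:: 2; 3; 4; 5; 7; 8]%N -> e R k \in U.
  move=> kI; apply: (subvP mU); apply/m12P; rewrite /e.
  by move: kI; rewrite !inE; do 5?[case/orP]; move=> /eqP->; do 6!eexists.
case=> [|[|[|[|[|[|[|[|[|k]]]]]]]]] // _; try exact: eU.
  by rewrite e1_bracket memvZ // lU ?eU.
by rewrite e6_bracket memvZ // lU ?eU.
Qed.

Lemma h20_0P X : X \in h20 0 0 0 <->
  exists s t, X = su_mx s 0 0 0 0 (- s / 2) 0 t :> gl3 R.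
Proof.
by rewrite h20P; split=> -[s [t ->]]; exists s, t; congr su_mx; field.
Qed.

Lemma m20_0P X : X \in m20 0 0 0 <->
  exists l2 l3 l4 l5 l6 l7, X = su_mx 0 l2 l3 l4 l5 l6 l7 0 :> gl3 R.
Proof.
split=> [Xm|[l2 [l3 [l4 [l5 [l6 [l7 ->]]]]]]]; last by apply/m20P; split; ring.
have [/suP[l1 [l2 [l3 [l4 [l5 [l6 [l7 [l8 E]]]]]]]] _] :=
  (m20_trace_orthogonal _ _ _ _).1 Xm.
move: Xm; rewrite E => /m20P[]; rewrite !(mulr0, mul0r, subr0, addr0) => -> ->.
by exists l2, l3, l4, l5, l6, l7.
Qed.

(** Only [e 1] and [e 8] are missing from this [m20]. *)
Lemma m20_0_generates : generates (su R) (m20 0 0 0).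
Proof.
split=> [|U [sU lU] mU].
  by apply/subvP=> X /m20_trace_orthogonal[].
apply/eqP; rewrite eqEsubv sU; apply: su_le.
have eU k : k \in [:: 2; 3; 4; 5; 6; 7]%N -> e R k \in U.
  move=> kI; apply: (subvP mU); apply/m20_0P; rewrite /e.
  by move: kI; rewrite !inE; do 5?[case/orP]; move=> /eqP->; do 6!eexists.
case=> [|[|[|[|[|[|[|[|[|k]]]]]]]]] // _; try exact: eU.
  by rewrite e1_bracket memvZ // lU ?eU.
by rewrite e8_bracket lU ?eU.
Qed.

Lemma complementaryP V h m : complementary V m h <->
  (m + h)%VS = V /\ forall X, X \in m -> X \in h -> X = 0.
Proof.
split=> -[S D]; split=> //.
  move: D => /directv_addP D X Xm Xh.
  by apply/eqP; rewrite -memv0 -D memv_cap Xm.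
apply/directv_addP/eqP; rewrite -subv0; apply/subvP=> X.
by rewrite memv_cap memv0 => /andP[Xm /(D _ Xm) ->].
Qed.

Lemma dim_span2 (X Y : gl3 R) :
  (forall a b : R, a *: X + b *: Y = 0 -> a = 0 /\ b = 0) ->
  \dim <<[:: X; Y]>> = 2%N.
Proof.
move=> XY; apply/eqP; change (free [:: X; Y]).
rewrite free_cons span_seq1 seq1_free; apply/andP; split.
  apply/negP=> /vlineP[k EX]; have [] := XY 1 (- k).
    by rewrite scale1r scaleNr EX subrr.
  by move/eqP; rewrite oner_eq0.
apply/negP=> /eqP Y0; have [] := XY 0 1; first by rewrite Y0 scale0r scaler0 addr0.
by move=> _ /eqP; rewrite oner_eq0.
Qed.

Lemma su_mx0 : 0 = su_mx 0 0 0 0 0 0 0 0 :> gl3 R.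
Proof. by rewrite -(scale0r (su_mx 0 0 0 0 0 0 0 0)) su_mxZ !mul0r. Qed.

Lemma admissible12 : admissible (h12 R) (m12 R).
Proof.
split; last exact: m12_generates; last first.
  apply: dim_span2 => a b; rewrite /e !su_mxG su_mx0 /= => /su_mx_inj.
  by rewrite !(mulr1, mulr0, addr0, add0r) => -[[-> _ _ _] [_ -> _ _]].
split.
- split; first by apply/subvP=> X /h12P[? [? ->]]; apply/suP; do 8!eexists.
  move=> A B /h12P[? [? ->]] /h12P[? [? ->]]; rewrite lie_su; apply/h12P.
  by do 2!eexists; congr su_mx; ring.
- apply/complementaryP; split; last first.
    move=> X /m12P[? [? [? [? [? [? ->]]]]]] /h12P[? [? /su_mx_inj]].
    by rewrite su_mx0 => -[[_ -> -> ->] [-> _ -> ->]].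
  apply/eqP; rewrite eqEsubv subv_add -andbA; apply/and3P; split.
  + by apply/subvP=> X /m12P[? [? [? [? [? [? ->]]]]]]; apply/suP; do 8!eexists.
  + by apply/subvP=> X /h12P[? [? ->]]; apply/suP; do 8!eexists.
  apply/subvP=> X /suP[l1 [l2 [l3 [l4 [l5 [l6 [l7 [l8 ->]]]]]]]].
  apply/memv_addP; exists (su_mx 0 l2 l3 l4 l5 0 l7 l8).
    by apply/m12P; do 6!eexists.
  exists (su_mx l1 0 0 0 0 l6 0 0); first by apply/h12P; do 2!eexists.
  by rewrite !su_mxG; congr su_mx; ring.
move=> A B /h12P[? [? ->]] /m12P[? [? [? [? [? [? ->]]]]]]; rewrite lie_su.
by apply/m12P; do 6!eexists; congr su_mx; ring.
Qed.

Lemma admissible20_0 : admissible (h20 0 0 0) (m20 (0 : R) 0 0).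
Proof.
split; last exact: m20_0_generates; last first.
  apply: dim_span2 => a b; rewrite /e !su_mxG su_mx0 /= => /su_mx_inj.
  rewrite !(mulr1, mulr0, mul0r, addr0, add0r, oppr0).
  by case=> -[-> _ _ _] [_ _ _ ->].
split.
- split; first by apply/subvP=> X /h20_0P[? [? ->]]; apply/suP; do 8!eexists.
  move=> A B /h20_0P[? [? ->]] /h20_0P[? [? ->]]; rewrite lie_su; apply/h20_0P.
  by exists 0, 0; congr su_mx; field.
- apply/complementaryP; split; last first.
    move=> X /m20_0P[? [? [? [? [? [? ->]]]]]] /h20_0P[? [? /su_mx_inj]].
    rewrite su_mx0 => -[[<- -> -> ->] [-> -> -> _]].
    by rewrite oppr0 mul0r.
  apply/eqP; rewrite eqEsubv subv_add -andbA; apply/and3P; split.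
  + by apply/subvP=> X /m20_0P[? [? [? [? [? [? ->]]]]]]; apply/suP; do 8!eexists.
  + by apply/subvP=> X /h20_0P[? [? ->]]; apply/suP; do 8!eexists.
  apply/subvP=> X /suP[l1 [l2 [l3 [l4 [l5 [l6 [l7 [l8 ->]]]]]]]].
  apply/memv_addP; exists (su_mx 0 l2 l3 l4 l5 (l6 + l1 / 2) l7 0).
    by apply/m20_0P; do 6!eexists.
  exists (su_mx l1 0 0 0 0 (- l1 / 2) 0 l8); first by apply/h20_0P; do 2!eexists.
  by rewrite !su_mxG; congr su_mx; field.
move=> A B /h20_0P[? [? ->]] /m20_0P[? [? [? [? [? [? ->]]]]]]; rewrite lie_su.
by apply/m20_0P; do 6!eexists; congr su_mx; field.
Qed.

End Converse.

(** * Transport along SU *)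

Section Transport.
Variable R : realType.
Notation C := R[i].
Implicit Types (A B X Y : gl3 R) (U V h m : {vspace gl3 R}) (g : 'M[C]_3).

Lemma SU_unit g : SU g -> g \in unitmx.
Proof. by case=> _ d1; rewrite unitmxE d1 unitr1. Qed.

Lemma SU_starJ g : SU g -> star g *m J R = J R *m invmx g.
Proof. by move=> gSU; case: (gSU) => E _; rewrite -[in RHS]E mulmxK // SU_unit. Qed.

Lemma SU_inv g : SU g -> SU (invmx g).
Proof.
move=> gSU; split; last by case: gSU => _; rewrite det_inv => ->; rewrite invr1.
change (star (invmx g) *m J R *m invmx g = J R).
rewrite -mulmxA -(SU_starJ gSU) mulmxA -starM mulmxV ?SU_unit // star1.
by rewrite mul1mx.
Qed.

Lemma SU_Jg g : SU g -> J R *m g = star (invmx g) *m J R.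
Proof. by move=> gSU; rewrite (SU_starJ (SU_inv gSU)) invmxK. Qed.

(** The form is defined on columns in [SU], while eigenvectors are rows here;
    a matrix preserves one form if and only if it preserves the other, because
    [J] is its own inverse. *)
Lemma SU_of_gram g : g *m J R *m star g = J R -> \det g = 1 -> SU g.
Proof.
move=> E d1; split=> //; change (star g *m J R *m g = J R).
have /mulmx1C E' : g *m (J R *m star g *m J R) = 1%:M by rewrite !mulmxA E JJ.
rewrite -[X in X *m J R]mul1mx -JJ -!mulmxA; rewrite -!mulmxA in E'.
by rewrite E' mulmx1.
Qed.

Lemma AdK g X : g \in unitmx -> Ad (invmx g) (Ad g X) = X.
Proof. by move=> gU; rewrite /Ad invmxK !mulmxA mulVmx // mul1mx mulmxKV. Qed.

Lemma AdKV g X : g \in unitmx -> Ad g (Ad (invmx g) X) = X.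
Proof. by move=> gU; rewrite -{1}[g]invmxK AdK // unitmx_inv. Qed.

Lemma Ad_lie g A B : g \in unitmx -> Ad g (lie A B) = lie (Ad g A) (Ad g B).
Proof.
move=> gU; rewrite /lie /Ad mulmxBr mulmxBl !mulmxA.
by rewrite !(mulmxKV gU).
Qed.

Lemma Ad_tr g A B : g \in unitmx -> \tr (Ad g A *m Ad g B) = \tr (A *m B).
Proof.
move=> gU; rewrite /Ad !mulmxA mulmxKV // mxtrace_mulC !mulmxA mulVmx //.
by rewrite mul1mx.
Qed.

Lemma Ad_su g X : SU g -> X \in su R -> Ad g X \in su R.
Proof.
move=> gSU /suE[Xs X0]; apply/suE; split; last first.
  by rewrite /Ad mxtrace_mulC mulmxA mulVmx ?mul1mx ?SU_unit.
rewrite /Ad !starM -!mulmxA (SU_starJ gSU) !mulmxA (SU_Jg gSU) -!mulmxA.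
rewrite -mulmxDr !mulmxA -mulmxDl Xs mul0mx mulmx0 //.
Qed.

Lemma mem_Ad g U X : g \in unitmx ->
  (X \in (linfun (Ad g) @: U)%VS) = (Ad (invmx g) X \in U).
Proof.
move=> gU; apply/memv_imgP/idP => [[Y YU ->]|XU].
  by rewrite lfunE /= AdK.
by exists (Ad (invmx g) X); rewrite // lfunE /= AdKV.
Qed.

Lemma mem_Ad_img g U X : g \in unitmx ->
  (Ad g X \in (linfun (Ad g) @: U)%VS) = (X \in U).
Proof. by move=> gU; rewrite mem_Ad // AdK. Qed.

Lemma img_AdK g U : g \in unitmx ->
  (linfun (Ad (invmx g)) @: (linfun (Ad g) @: U))%VS = U.
Proof.
move=> gU; apply/vspaceP=> X.
by rewrite mem_Ad ?unitmx_inv // invmxK mem_Ad_img.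
Qed.

Lemma Ad_img_su g : SU g -> (linfun (Ad g) @: su R)%VS = su R.
Proof.
move=> gSU; have gU := SU_unit gSU; apply/vspaceP=> X; rewrite (mem_Ad _ _ gU).
apply/idP/idP => [XU|]; last exact/Ad_su/SU_inv.
by rewrite -(AdKV X gU) Ad_su.
Qed.

Lemma conjugate_pair_sym h m h' m' :
  conjugate_pair h m h' m' -> conjugate_pair h' m' h m.
Proof.
move=> [g [gSU <- <-]]; have gU := SU_unit gSU.
by exists (invmx g); rewrite !img_AdK //; split=> //; apply: SU_inv.
Qed.

Lemma subalgebra_Ad g U : SU g ->
  subalgebra (su R) U -> subalgebra (su R) (linfun (Ad g) @: U)%VS.
Proof.
move=> gSU [sU lU]; have gU := SU_unit gSU; have gV := SU_unit (SU_inv gSU).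
split.
  by rewrite -(Ad_img_su gSU) limgS.
by move=> A B; rewrite !(mem_Ad _ _ gU) (Ad_lie _ _ gV); apply: lU.
Qed.

Lemma admissible_conjugate h m h' m' :
  conjugate_pair h m h' m' -> admissible h m -> admissible h' m'.
Proof.
move=> [g [gSU <- <-]] [[subh /complementaryP[mh mh0] hm] dimh [mg gen]].
have gU := SU_unit gSU; have gV := SU_unit (SU_inv gSU).
split; [split | | split].
- exact: subalgebra_Ad.
- apply/complementaryP; rewrite -limgD mh Ad_img_su //; split=> // X.
  rewrite !(mem_Ad _ _ gU) => Xm Xh.
  by rewrite -(AdKV X gU) (mh0 _ Xm Xh) linear0.
- by move=> A B; rewrite !(mem_Ad _ _ gU) (Ad_lie _ _ gV); apply: hm.
- rewrite -dimh limg_dim_eq //; apply/eqP; rewrite -subv0; apply/subvP=> X.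
  rewrite memv_cap memv_ker lfunE memv0 /= => /andP[_ /eqP AX0].
  by rewrite -(AdK X gU) AX0 linear0.
- by rewrite -(Ad_img_su gSU) limgS.
move=> U sU mU; rewrite -[U](img_AdK _ (_ : invmx g \in unitmx)) ?unitmx_inv //.
rewrite invmxK (gen (linfun (Ad (invmx g)) @: U)%VS) ?Ad_img_su //.
  by apply: subalgebra_Ad => //; apply: SU_inv.
by rewrite -[m](img_AdK _ gU) limgS.
Qed.

End Transport.

(** * The three-parameter family is one conjugacy class *)

Section Unipotent.
Variable R : realType.
Notation C := R[i].
Implicit Types (A B X Y : gl3 R) (U V h m : {vspace gl3 R}) (g : 'M[C]_3).

(** This is the exponential of
    [- a (e 2 + e 5) - b (e 4 - e 3) - (c / 2) (e 6 + e 7)], an element of the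
    nilradical of a Borel subalgebra. Its cube is zero, so the series stops after
    the quadratic term. *)
Definition unipotent (a b c : R) : 'M[C]_3 :=
  let n := (a ^+ 2 + b ^+ 2) / 2 in
  mx3 (1 +i* 0)%C         (a +i* (- b))%C               ((- b) +i* (- a))%C
      ((- a) +i* (- b))%C ((1 - n) +i* (- (c / 2)))%C   ((- (c / 2)) +i* n)%C
      ((- b) +i* a)%C     ((- (c / 2)) +i* n)%C         ((1 + n) +i* (c / 2))%C.

Lemma unipotent_SU a b c : SU (unipotent a b c).
Proof.
split.
  change (star (unipotent a b c) *m J R *m unipotent a b c = J R).
  rewrite /unipotent mx3_star mx3_J !mx3M.
  by congr mx3; apply: complex_ext => /=; field.
rewrite /unipotent mx3_det.
by apply: complex_ext => /=; field.
Qed.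

(** Conjugation carries the two spanning vectors exactly to those of
    [h20 a b c], so [s] and [t] do not change. *)
Lemma unipotent_h20 (a b c : R) :
  (linfun (Ad (unipotent a b c)) @: h20 0 0 0)%VS = h20 a b c.
Proof.
have gSU := unipotent_SU a b c; have gU := SU_unit gSU.
have [_ dim0 _] := admissible_conjugate (ex_intro _ _ (And3 gSU erefl erefl))
  (admissible20_0 R).
apply/eqP; rewrite eqEdim dim0 dim_span andbT; apply/subvP=> X.
rewrite (mem_Ad _ _ gU) => /h20_0P[s [t E]].
have -> : X = Ad (unipotent a b c) (su_mx s 0 0 0 0 (- s / 2) 0 t) by rewrite -E AdKV.
apply/h20P; exists s, t; rewrite /Ad; apply: (canLR (mulmxK gU)).
rewrite !su_mxE /unipotent !mx3M.
by congr mx3; apply: complex_ext => /=; field.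
Qed.

Lemma trace_orthogonal_Ad g U X : SU g ->
  trace_orthogonal (linfun (Ad g) @: U)%VS X <-> trace_orthogonal U (Ad (invmx g) X).
Proof.
move=> gSU; have gU := SU_unit gSU; split=> -[Xsu X0]; split.
- by apply: Ad_su => //; apply: SU_inv.
- move=> H HU; rewrite -(AdK H gU) Ad_tr ?unitmx_inv //.
  by apply: X0; rewrite mem_Ad_img.
- by rewrite -(AdKV X gU) Ad_su.
move=> H; rewrite (mem_Ad _ _ gU) => /X0; rewrite Ad_tr ?unitmx_inv //.
Qed.

(** Since [m20] is the trace-orthogonal of [h20], it follows [h20] under [Ad]. *)
Lemma h20_conjugate (a b c : R) :
  conjugate_pair (h20 0 0 0) (m20 0 0 0) (h20 a b c) (m20 a b c).
Proof.
have gSU := unipotent_SU a b c; exists (unipotent a b c).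
split=> //; first exact: unipotent_h20.
apply/vspaceP=> X; rewrite (mem_Ad _ _ (SU_unit gSU)).
apply/idP/idP => /m20_trace_orthogonal XO; apply/m20_trace_orthogonal.
  by rewrite -(unipotent_h20 a b c); apply: (trace_orthogonal_Ad _ _ gSU).2.
by apply: (trace_orthogonal_Ad _ _ gSU).1; rewrite unipotent_h20.
Qed.

End Unipotent.

(** * No nilpotent directions *)

Section Nilpotent.
Variable R : realType.
Notation C := R[i].
Implicit Types (A B X Y F : gl3 R) (U V h m : {vspace gl3 R}) (Q : 'M[C]_3).

(** In an sl2-triple the lowering operator [F] satisfies [[N, [N, F]]] = -2 N; the
    factor is absorbed in [F]. If [N^2 = 0], the equation reads [- 2 N F N = N], and
    one entry of [F] suffices. When [N] has rank two, it is conjugate to its part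
    next to the diagonal by a lower unipotent matrix, and [z] is the entry of that
    matrix. *)
Lemma lower_jacobson_morozov (a b c : C) :
  let N : gl3 R := mx3 0 0 0 a 0 0 b c 0 in
  exists2 F, lie N (lie N F) = N & \tr F = 0.
Proof.
rewrite /lie; have [->|a0] := eqVneq a 0; have [->|c0] := eqVneq c 0.
- have [->|b0] := eqVneq b 0.
    by exists (mx3 0 0 0 0 0 0 0 0 0); rewrite ?mx3_tr ?addr0 //;
      rewrite !(mx3M, mx3N, mx3D); congr mx3; ring.
  exists (mx3 0 0 (- (1 / (2 * b))) 0 0 0 0 0 0); rewrite ?mx3_tr ?addr0 //.
  by rewrite !(mx3M, mx3N, mx3D); congr mx3; field.
- exists (mx3 0 0 0 0 0 (- (1 / (2 * c))) 0 0 0); rewrite ?mx3_tr ?addr0 //.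
  by rewrite !(mx3M, mx3N, mx3D); congr mx3; field.
- exists (mx3 0 (- (1 / (2 * a))) 0 0 0 0 0 0 0); rewrite ?mx3_tr ?addr0 //.
  by rewrite !(mx3M, mx3N, mx3D); congr mx3; field.
pose z := - (b / c).
exists (mx3 (z / a) (- a^-1) 0 (z ^+ 2 / a) (- (z / a)) (- c^-1) 0 0 0).
  by rewrite !(mx3M, mx3N, mx3D) /z; congr mx3; field; rewrite a0 c0.
by rewrite mx3_tr subrr addr0.
Qed.

(** On trace-free matrices, the antilinear involution whose fixed points form su. *)
Definition sigma A : gl3 R := - (J R *m star A *m J R).

Lemma sigma_lie A B : sigma (lie A B) = lie (sigma A) (sigma B).
Proof.
suff K (A' B' : 'M[C]_3) : - (J R *m star (A' *m B' - B' *m A') *m J R) =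
    - (J R *m star A' *m J R) *m - (J R *m star B' *m J R)
    - - (J R *m star B' *m J R) *m - (J R *m star A' *m J R) by exact: K.
have JJK (M N : 'M[C]_3) :
    - (J R *m M *m J R) *m - (J R *m N *m J R) = J R *m (M *m N) *m J R.
  by rewrite mulNmx mulmxN opprK !mulmxA -(mulmxA _ (J R) (J R)) JJ mulmx1.
transitivity (J R *m (star A' *m star B') *m J R
              - J R *m (star B' *m star A') *m J R); last by congr (_ - _).
rewrite -mulmxBl -mulmxBr starD starN (starM A') (starM B').
by rewrite -mulNmx -mulmxN opprB.
Qed.

Lemma sigma_skew A : sigma A = A <-> star A *m J R + J R *m A = 0.
Proof.
rewrite /sigma; split=> [E|E].
  by rewrite -[in J R *m A]E mulmxN !mulmxA JJ mul1mx subrr.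
move/eqP: E; rewrite addr_eq0 => /eqP E.
by rewrite -mulmxA E mulmxN mulmxA JJ mul1mx opprK.
Qed.

Lemma sigmaK A : sigma (sigma A) = A.
Proof.
rewrite /sigma starN !starM starK star_J mulmxN mulNmx opprK.
by rewrite !mulmxA JJ mul1mx -mulmxA JJ mulmx1.
Qed.

Lemma sigmaD A B : sigma (A + B) = sigma A + sigma B.
Proof. by rewrite /sigma starD mulmxDr mulmxDl opprD. Qed.

Lemma sigmaZ (a : R) A : sigma (a *: A) = a *: sigma A.
Proof.
by rewrite /sigma !gl3_scaleE star_real -scalemxAr -scalemxAl scalerN.
Qed.

Lemma sigma_tr A : \tr A = 0 -> \tr (sigma A) = 0.
Proof.
move=> A0; rewrite /sigma linearN /= mxtrace_mulC mulmxA JJ mul1mx tr_star A0.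
by rewrite conjc0 oppr0.
Qed.

(** The complex solution is averaged with its image under [sigma]; the equation
    is compatible with this because [sigma] fixes [Y]. *)
Lemma jacobson_morozov Y Q (a b c : C) : Q \in unitmx -> Y \in su R ->
  Ad Q Y = mx3 0 0 0 a 0 0 b c 0 ->
  exists2 F, F \in su R & lie Y (lie Y F) = Y.
Proof.
move=> QU /suE[Ysk _] YN; have [F0 EF0 trF0] := lower_jacobson_morozov a b c.
pose F : gl3 R := Ad (invmx Q) F0.
have QU' : invmx Q \in unitmx by rewrite unitmx_inv.
have EF : lie Y (lie Y F) = Y.
  by rewrite -[Y](AdK _ QU) -!(Ad_lie _ _ QU') YN EF0.
have trF : \tr F = 0.
  by rewrite /F /Ad invmxK mxtrace_mulC mulmxA mulmxV // mul1mx.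
exists ((1 / 2) *: (F + sigma F)); last first.
  clearbody F; have sY := (sigma_skew Y).2 Ysk.
  have EsF : lie Y (lie Y (sigma F)) = Y.
    by rewrite -[in LHS]sY -!sigma_lie EF.
  rewrite lieZr lieDr lieZr lieDr EF EsF -mulr2n -scaler_nat scalerA.
  by rewrite div1r mulVf ?scale1r // pnatr_eq0.
apply/suE; split.
  by apply/sigma_skew; rewrite sigmaZ sigmaD sigmaK addrC.
by rewrite gl3_scaleE linearZ /= linearD /= trF sigma_tr // addr0 mulr0.
Qed.

(** Write [F = M + H] along [m + h]. As [ad Y] kills [H] in two steps,
    [Y = [Y, [Y, M]]] lies in [m] as well as in [h]. *)
Lemma reductive_no_nilpotent h m Y Q (a b c : C) :
  reductive (su R) h m -> Y \in h ->
  (forall H, H \in h -> lie Y (lie Y H) = 0) ->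
  Q \in unitmx -> Ad Q Y = mx3 0 0 0 a 0 0 b c 0 -> Y = 0.
Proof.
move=> [[hs _] /complementaryP[mh mh0] hm] Yh Y2 QU YN.
have [F Fs EF] := jacobson_morozov QU (subvP hs _ Yh) YN.
move: Fs; rewrite -mh => /memv_addP[M Mm [H Hh FE]].
apply: mh0 => //; rewrite -EF FE (lieDr M H Y) (lieDr (lie Y M) _ Y) (Y2 _ Hh) addr0.
exact: (hm _ _ Yh (hm _ _ Yh Mm)).
Qed.

End Nilpotent.

(** * h is abelian and contains a regular element *)

(** The inverse of [Q] is a separate matrix [Q'], so that taking R[i] for [F] does
    not require comparing two inversion operations. *)
Lemma cotriangular_closed (F : numClosedFieldType) n (A B : 'M[F]_n) :
  A *m B = B *m A -> exists Q Q' : 'M[F]_n,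
    [/\ Q *m Q' = 1%:M, is_trig_mx (Q *m A *m Q') & is_trig_mx (Q *m B *m Q')].
Proof.
move=> /cotrigonalization2[Q /unitarymx_unit QU /andP[]] TA TB.
exists Q, (invmx Q); split; first exact: mulmxV.
  by rewrite -conjumx.
by rewrite -conjumx.
Qed.

Lemma cotriangular (R : realType) (A B : 'M[R[i]]_3) : A *m B = B *m A ->
  exists2 Q, Q \in unitmx &
    is_trig_mx (Q *m A *m invmx Q) /\ is_trig_mx (Q *m B *m invmx Q).
Proof.
move=> AB; have [Q [Q' [Q1 TA TB]]] := @cotriangular_closed R[i] 3 A B AB.
have [QU _] := mulmx1_unit Q1; exists Q; first exact: QU.
have <- : Q' = invmx Q by rewrite -[LHS](mulKmx QU) Q1 mulmx1.
split; [exact TA | exact TB].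
Qed.

Section Regular.
Variable R : realType.
Notation C := R[i].
Implicit Types (A B X Y F : gl3 R) (U V h m : {vspace gl3 R}) (Q : 'M[C]_3).

Lemma trig_mx3 (T : 'M[C]_3) : is_trig_mx T ->
  T = mx3 (T o0 o0) 0 0 (T o1 o0) (T o1 o1) 0 (T o2 o0) (T o2 o1) (T o2 o2).
Proof.
by move=> /is_trig_mxP T0; rewrite [LHS]mx3_eta (T0 o0 o1) // (T0 o0 o2) // (T0 o1 o2).
Qed.

Lemma Ad_mulmx Q A B : Q \in unitmx -> Ad Q A *m Ad Q B = Ad Q (A *m B).
Proof. by move=> QU; rewrite /Ad !mulmxA (mulmxKV QU). Qed.

Lemma tr_Ad Q A : Q \in unitmx -> \tr (Ad Q A) = \tr A.
Proof. by move=> QU; rewrite /Ad mxtrace_mulC mulmxA mulVmx // mul1mx. Qed.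

Lemma trig_traces Q X : Q \in unitmx -> is_trig_mx (Ad Q X) ->
  let t i := Ad Q X i i in
  [/\ t o0 + t o1 + t o2 = \tr X,
      t o0 ^+ 2 + t o1 ^+ 2 + t o2 ^+ 2 = \tr (X *m X)
    & t o0 ^+ 3 + t o1 ^+ 3 + t o2 ^+ 3 = \tr (X *m X *m X)].
Proof.
move=> QU /trig_mx3; rewrite -(tr_Ad X QU) -(tr_Ad (X *m X) QU).
rewrite -(tr_Ad (X *m X *m X) QU) -(Ad_mulmx (X *m X) X QU) -(Ad_mulmx X X QU).
move: (Ad Q X) => T ET; rewrite /= [in \tr T]ET [in T *m T *m T]ET [in T *m T]ET.
by rewrite !mx3M !mx3_tr; split; ring.
Qed.

(** Newton: vanishing power sums in characteristic zero force a nilpotent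
    spectrum. *)
Lemma power_sums_eq0 (x y z : C) : x + y + z = 0 -> x ^+ 2 + y ^+ 2 + z ^+ 2 = 0 ->
  x ^+ 3 + y ^+ 3 + z ^+ 3 = 0 -> [/\ x = 0, y = 0 & z = 0].
Proof.
move=> e1 e2 e3; have Ez : z = - (x + y).
  by apply/eqP; rewrite -addr_eq0 addrC e1.
subst z.
have /eqP : x * y * (x + y) = 0.
  apply: (mulfI (_ : 3 != 0 :> C)); first by rewrite pnatr_eq0.
  by rewrite mulr0 -[RHS]oppr0 -[in RHS]e3; ring.
have E2 : x * (x + y) + y ^+ 2 = 0.
  apply: (mulfI (_ : 2 != 0 :> C)); first by rewrite pnatr_eq0.
  by rewrite mulr0 -[RHS]e2; ring.
rewrite !mulf_eq0 -orbA => /or3P[] /eqP E; move: E2.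
- rewrite E mul0r !add0r => /eqP; rewrite sqrf_eq0 => /eqP->.
  by rewrite oppr0.
- rewrite E expr0n /= !addr0 => /eqP; rewrite mulf_eq0 orbb => /eqP->.
  by rewrite oppr0.
rewrite E mulr0 add0r => /eqP; rewrite sqrf_eq0 => /eqP y0.
by move: E; rewrite y0 addr0 => ->; rewrite oppr0.
Qed.

Lemma dim2_basis h : \dim h = 2%N -> exists A B,
  [/\ A \in h, B \in h,
      forall X, X \in h -> exists p q : R, X = p *: A + q *: B
    & forall p q : R, p *: A + q *: B = 0 -> p = 0 /\ q = 0].
Proof.
move=> dimh; have := vbasisP h; move: (vbasis h); rewrite dimh => b /andP[/eqP].
case/tupleP: b => A b; case/tupleP: b => B b; rewrite tuple0 /= => <- fb.
exists A, B; split; try by rewrite memv_span // !inE eqxx ?orbT.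
  move=> X; case/mem_span_cons=> p; case/mem_span_cons=> q.
  by rewrite span_nil memv0 subr_eq0 !subr_eq => /eqP->; exists p, q; rewrite addrC.
move=> p q; move: fb; rewrite free_cons span_seq1 seq1_free => /andP[AB B0] E.
have p0 : p = 0.
  apply: contraNeq AB => p0; apply/vlineP; exists (- (p^-1 * q)).
  have /eqP := congr1 (fun Z => p^-1 *: Z) E; rewrite scalerDr !scalerA mulVf //.
  by rewrite scale1r scaler0 addr_eq0 scaleNr => /eqP.
split=> //; move/eqP: E; rewrite p0 scale0r add0r scaler_eq0 (negPf B0) orbF.
by move/eqP.
Qed.

(** Otherwise the derived algebra is a line spanned by some [Y] with [[x, Y] = Y].
    Then all traces of powers of [Y] vanish by cyclicity, so [Y] is nilpotent. *)
Lemma reductive_abelian h m : reductive (su R) h m -> \dim h = 2%N ->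
  forall A B, A \in h -> B \in h -> lie A B = 0.
Proof.
move=> red dimh; have [A [B [Ah Bh span _]]] := dim2_basis dimh.
have lieAA X : lie X X = 0 by rewrite /lie subrr.
case: (red) => -[_ lh] _ _.
have sub X Y : X \in h -> Y \in h -> exists k : R, lie X Y = k *: lie A B.
  move=> /span[p [q ->]] /span[r [s ->]]; exists (p * s - q * r).
  rewrite (lieDl (p *: A) (q *: B)) (lieZl p A) (lieZl q B).
  rewrite (lieDr (r *: A) (s *: B) A) (lieDr (r *: A) (s *: B) B).
  rewrite (lieZr r A A) (lieZr s B A) (lieZr r A B) (lieZr s B B) !lieAA (lieC A B).
  by rewrite !scaler0 add0r addr0 !scalerN !scalerA scalerBl.
suff AB0 : lie A B = 0 by move=> X Y /sub/[apply] -[k ->]; rewrite AB0 scaler0.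
apply/eqP/negPn/negP => /eqP Y0; have := lh A B Ah Bh.
move: sub Y0; set Y := lie A B => sub Y0 Yh.
have [x xh xY] : exists2 x, x \in h & lie x Y = Y.
  have [al [be EY]] := span _ Yh.
  have [be0|be0] := eqVneq be 0; last first.
    exists (be^-1 *: A); first exact: memvZ.
    rewrite (lieZl be^-1 A) EY (lieDr (al *: A) (be *: B) A) (lieZr al A A).
    rewrite (lieZr be B A) lieAA scaler0 add0r scalerA -/Y -EY.
    by rewrite mulVf ?scale1r.
  have al0 : al != 0.
    by apply/eqP => al0; apply: Y0; rewrite EY al0 be0 !scale0r addr0.
  exists (- al^-1 *: B); first exact: memvZ.
  rewrite (lieZl (- al^-1) B) EY (lieDr (al *: A) (be *: B) B) (lieZr al A B).
  rewrite (lieZr be B B) lieAA scaler0 addr0 scalerA -EY.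
  by rewrite (lieC A B) scalerN mulNr scaleNr opprK mulVf ?scale1r.
have Ysu : Y \in su R by case: red => -[/subvP hs _] _ _; apply: hs.
have [Q QU [TY _]] := cotriangular (erefl (Y *m Y)).
have := trig_traces QU TY; have /suE[_ ->] := Ysu.
have cyc (Z : 'M[C]_3) : Y *m Z = Z *m Y -> \tr (Y *m Z) = 0.
  move=> YZ; rewrite -{1}xY /lie mulmxBl linearB /= -mulmxA YZ mulmxA.
  by rewrite -(mulmxA Y x Z) (mxtrace_mulC Y) subrr.
rewrite cyc // -mulmxA cyc ?mulmxA //.
move=> [e1 e2 e3]; have [t0 t1 t2] := power_sums_eq0 e1 e2 e3.
apply: Y0; apply: (reductive_no_nilpotent red Yh _ QU).
  move=> H Hh; have [k ->] := sub _ _ Yh Hh; by rewrite lieZr lieAA scaler0.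
by rewrite {1}[Ad Q Y]trig_mx3 // t0 t1 t2.
Qed.

End Regular.

Section RegularElement.
Variable R : realType.
Notation C := R[i].
Implicit Types (A B X Y F : gl3 R) (U V h m : {vspace gl3 R}) (Q : 'M[C]_3).

(** The adjoint of [X] is [- J X J], so the eigenvalues of [X] are stable under
    [z |-> - z^*]. *)
Lemma su_traces X : X \in su R ->
  ((\tr (X *m X))^*)%C = \tr (X *m X) /\
  ((\tr (X *m X *m X))^*)%C = - \tr (X *m X *m X).
Proof.
move=> /suE[/sigma_skew Xs _].
have E : star X = - (J R *m X *m J R).
  by rewrite -[in RHS]Xs /sigma mulmxN mulNmx opprK !mulmxA JJ mul1mx -mulmxA JJ mulmx1.
have JJK (M N : 'M[C]_3) :
    J R *m M *m J R *m (J R *m N *m J R) = J R *m (M *m N) *m J R.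
  by rewrite !mulmxA -(mulmxA _ (J R) (J R)) JJ mulmx1.
have trJ (M : 'M[C]_3) : \tr (J R *m M *m J R) = \tr M.
  by rewrite mxtrace_mulC mulmxA JJ mul1mx.
rewrite -!tr_star !starM E mulNmx mulmxN opprK JJK trJ; split=> //.
by rewrite mulNmx JJK linearN /= trJ mulmxA.
Qed.

Lemma double_weight_imaginary (x : C) :
  ((6 * x ^+ 2)^*)%C = 6 * x ^+ 2 -> ((- 6 * x ^+ 3)^*)%C = 6 * x ^+ 3 ->
  complex.Re x = 0.
Proof.
have n6 : 6 != 0 :> C by rewrite pnatr_eq0.
have cj n : ((6 * x ^+ n)^*)%C = 6 * (x^*)%C ^+ n.
  by rewrite (rmorphM conjc) (rmorphXn conjc); congr (_ * _); apply: conjc_nat.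
rewrite mulNr (rmorphN conjc) !cj => /(mulfI n6) E2.
move=> E3'; have {E3'} E3 : (x^*)%C ^+ 3 = - x ^+ 3.
  by apply: (mulfI n6); rewrite mulrN -E3' opprK; apply/esym/cj.
have : (x^*%C - x) * (x^*%C + x) = 0 by rewrite -subr_sqr E2 subrr.
move/eqP; rewrite mulf_eq0 subr_eq0 addr_eq0 => /orP[]/eqP E.
  have /eqP : x ^+ 3 *+ 2 = 0 by rewrite mulr2n -{1}E E3 addNr.
  by rewrite -mulr_natl mulf_eq0 pnatr_eq0 expf_eq0 /= => /eqP->.
move: E; case: x {cj E2 E3} => a b [] /eqP.
by rewrite -addr_eq0 -mulr2n mulrn_eq0 => /eqP.
Qed.

(** The spectrum is [{x, x, - 2 x}] and is stable under [z |-> - z^*], which must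
    then fix the double eigenvalue. *)
Lemma weight_imaginary Q X (i j : 'I_3) : X \in su R -> Q \in unitmx ->
  is_trig_mx (Ad Q X) -> i != j -> Ad Q X i i = Ad Q X j j ->
  complex.Re (Ad Q X i i) = 0.
Proof.
move=> Xsu QU TX ij; have [] := trig_traces QU TX.
have /suE[_ ->] := Xsu; have [] := su_traces Xsu.
set t := Ad Q X => c2 c3 e1 e2 e3.
suff K (x y : C) : x + x + y = 0 -> x ^+ 2 + x ^+ 2 + y ^+ 2 = \tr (X *m X) ->
    x ^+ 3 + x ^+ 3 + y ^+ 3 = \tr (X *m X *m X) -> complex.Re x = 0.
  case: (ord3P i) ij => ->; case: (ord3P j) => -> // _ E;
    [ apply: (K _ (t o2 o2)) | apply: (K _ (t o1 o1)) | apply: (K _ (t o2 o2))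
    | apply: (K _ (t o0 o0)) | apply: (K _ (t o1 o1)) | apply: (K _ (t o0 o0)) ];
    by [ rewrite -[RHS]e1 E; ring | rewrite -[RHS]e2 E; ring
       | rewrite -[RHS]e3 E; ring ].
move=> f1 f2 f3; have Ey : y = - (x + x) by apply/eqP; rewrite -addr_eq0 addrC f1.
apply: double_weight_imaginary.
  by rewrite (_ : 6 * x ^+ 2 = \tr (X *m X)) // -f2 Ey; ring.
rewrite (_ : - 6 * x ^+ 3 = \tr (X *m X *m X)); last by rewrite -f3 Ey; ring.
by rewrite c3 -f3 Ey; ring.
Qed.

(** A product of three nonzero affine functions cannot vanish at the four points
    0, 1, 2, 3. *)
Lemma avoid_zeros (u v : 'I_3 -> C) : (forall i, u i = 0 -> v i = 0 -> False) ->
  exists n : nat, forall i, u i + n%:R * v i != 0.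
Proof.
move=> uv; pose p i : {poly C} := (u i)%:P + v i *: 'X.
have p0 i : p i != 0.
  apply/eqP => pi0; apply: (uv i).
    by have := congr1 (fun q : {poly C} => q`_0) pi0;
      rewrite /p coefD coefC coefZ coefX coef0 /= mulr0 addr0.
  by have := congr1 (fun q : {poly C} => q`_1) pi0;
    rewrite /p coefD coefC coefZ coefX coef0 /= mulr1 add0r.
have sp i : (size (p i) <= 2)%N.
  rewrite (leq_trans (size_polyD _ _)) // geq_max.
  rewrite (leq_trans (size_polyC_leq1 _)) //.
  by rewrite (leq_trans (size_scale_leq _ _)) ?size_polyX.
pose q := p o0 * p o1 * p o2.
have q0 : q != 0 by rewrite !mulf_neq0.
have sq : (size q <= 4)%N.
  apply: leq_trans (size_polyMleq _ _) _; rewrite -ltnS prednK; last first.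
    by rewrite addn_gt0 size_poly_gt0 mulf_neq0.
  rewrite -[5%N]/(3 + 2)%N leq_add // (leq_trans (size_polyMleq _ _)) //.
  by rewrite -[3%N]/((2 + 2).-1)%N -!subn1 leq_sub2r // leq_add.
have /allPn[_ /mapP[n _ ->] qn] : ~~ all (root q) [seq n%:R | n <- iota 0 4].
  apply/negP => qr; have := max_poly_roots q0 qr.
  rewrite map_inj_uniq ?iota_uniq; last first.
    by move=> k l /eqP; rewrite eqr_nat => /eqP.
  by rewrite size_map size_iota ltnNge sq => /(_ isT).
exists n => i; move: qn; rewrite /root !hornerM !mulf_eq0 !negb_or -andbA.
have E k : (p k).[n%:R] = u k + n%:R * v k.
  by rewrite /p hornerD hornerC hornerZ hornerX mulrC.
by rewrite !E => /and3P[]; case: (ord3P i) => ->.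
Qed.

Lemma strictly_lower (T : 'M[C]_3) : is_trig_mx T -> (forall i, T i i = 0) ->
  T = mx3 0 0 0 (T o1 o0) 0 0 (T o2 o0) (T o2 o1) 0.
Proof. by move=> TT T0; rewrite [LHS]trig_mx3 // !T0. Qed.

(** If two weights agreed on all of [h], their common value would be imaginary, so
    it would have a nonzero kernel on the plane [h]; there all weights vanish,
    because they add up to zero, and this gives a nilpotent element. Hence the
    weights are pairwise distinct functionals, and a generic element of [h]
    separates them. *)
Lemma regular_element h m : reductive (su R) h m -> \dim h = 2%N ->
  exists X Q, [/\ X \in h, Q \in unitmx, is_trig_mx (Ad Q X)
    & forall i j, i != j -> Ad Q X i i != Ad Q X j j].
Proof.
move=> red dimh; have [A [B [Ah Bh span fAB]]] := dim2_basis dimh.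
have ab := reductive_abelian red dimh.
have AB : A *m B = B *m A by apply/eqP; rewrite -subr_eq0; apply/eqP/ab.
have [Q QU [TA TB]] := cotriangular AB; rewrite -!/(Ad Q _) in TA TB.
have [/is_trig_mxP TA0 /is_trig_mxP TB0] := (TA, TB).
have hs X : X \in h -> X \in su R by case: (red) => -[/subvP hs _] _ _; apply: hs.
have AdE (p q : R) : Ad Q (p *: A + q *: B) = p%:C%C *: Ad Q A + q%:C%C *: Ad Q B.
  by rewrite linearD !linearZ.
have AdEij p q i j : Ad Q (p *: A + q *: B) i j
    = p%:C%C * Ad Q A i j + q%:C%C * Ad Q B i j by rewrite AdE !mxE.
have trigE (p q : R) : is_trig_mx (Ad Q (p *: A + q *: B)).
  apply/is_trig_mxP => i j ij; rewrite AdEij.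
  by rewrite TA0 // TB0 // !mulr0 addr0.
have sep i j : i != j -> Ad Q A i i = Ad Q A j j -> Ad Q B i i = Ad Q B j j -> False.
  move=> ij EA EB; have RA := weight_imaginary (hs _ Ah) QU TA ij EA.
  have RB := weight_imaginary (hs _ Bh) QU TB ij EB.
  have [p [q [pq0 E0]]] : exists p q : R, (p, q) <> (0, 0) /\
      p * complex.Im (Ad Q A i i) + q * complex.Im (Ad Q B i i) = 0.
    have [A0|A0] := eqVneq (complex.Im (Ad Q A i i)) 0.
      by exists 1, 0; split; [case=> /eqP; rewrite oner_eq0 | rewrite A0; ring].
    exists (complex.Im (Ad Q B i i)), (- complex.Im (Ad Q A i i)).
    by split; [case=> _ /eqP; rewrite oppr_eq0 (negPf A0) | ring].
  pose X := p *: A + q *: B; have Xh : X \in h by rewrite memvD ?memvZ.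
  have Xi : Ad Q X i i = 0.
    move: RA RB E0; rewrite AdEij.
    case: (Ad Q A i i) => a a'; case: (Ad Q B i i) => b b' /= -> -> E0.
    by apply/eqP; rewrite eq_complex /= !mul0r !mulr0 !subr0 !addr0 E0 !eqxx.
  have Xj : Ad Q X j j = 0 by rewrite -[RHS]Xi !AdEij EA EB.
  have X0 k : Ad Q X k k = 0.
    have [e1 _ _] := trig_traces QU (trigE p q); move: e1; rewrite -/X.
    have /suE[_ ->] := hs _ Xh; move: Xi Xj ij.
    case: (ord3P i) => ->; case: (ord3P j) => -> // Xi Xj _; rewrite Xi Xj;
    by case: (ord3P k) => ->; rewrite ?Xi ?Xj ?add0r ?addr0.
  apply: pq0; have [|-> -> //] := fAB p q.
  apply: (reductive_no_nilpotent red Xh _ QU (strictly_lower (trigE p q) X0)).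
  by move=> H Hh; rewrite (ab X H) // (ab X 0) // mem0v.
(* The cyclic successor meets each pair of distinct indices once. *)
pose nx (i : 'I_3) := if i == o0 then o1 else if i == o1 then o2 else o0.
have nxi i : i != nx i by case: (ord3P i) => ->.
have [n n0] : exists n : nat, forall i, (Ad Q A i i - Ad Q A (nx i) (nx i))
    + n%:R * (Ad Q B i i - Ad Q B (nx i) (nx i)) != 0.
  apply: avoid_zeros => i /eqP; rewrite subr_eq0 => /eqP EA /eqP.
  by rewrite subr_eq0 => /eqP EB; apply: (sep i (nx i)).
pose X := 1 *: A + n%:R *: B; have Xh : X \in h by rewrite memvD ?memvZ.
have dn i : Ad Q X i i != Ad Q X (nx i) (nx i).
  rewrite -subr_eq0 !AdEij; apply: contraNneq (n0 i) => <-.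
  by rewrite rmorph1 rmorph_nat; apply/eqP; ring.
exists X, Q; split; [exact: Xh | exact: QU | exact: trigE |].
move: (Ad Q X) dn => T dn i j.
have d01 : T o0 o0 != T o1 o1 := dn o0.
have d12 : T o1 o1 != T o2 o2 := dn o1.
have d20 : T o2 o2 != T o0 o0 := dn o2.
by case: (ord3P i) => ->; case: (ord3P j) => -> // _; rewrite 1?eq_sym.
Qed.

End RegularElement.

(** * Eigenbases and their Gram matrices *)

Section Diagonalisation.
Variable R : realType.
Notation C := R[i].
Implicit Types (X : gl3 R) (P Q T K : 'M[C]_3) (d : 'rV[C]_3).

(** The rows of [P] are eigenvectors of [X] for distinct eigenvalues. *)
Definition eigenbasis X P d :=
  [/\ P \in unitmx, P *m (X : 'M[C]_3) = diag_mx d *m P & injective (d 0)].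

(** Back substitution: the [u] below solve the eigenvector equations row by row. *)
Lemma trig_eigenbasis T : is_trig_mx T -> (forall i j, i != j -> T i i != T j j) ->
  exists U d, [/\ \det U = 1, U *m T = diag_mx d *m U & injective (d 0)].
Proof.
move=> TT dT; pose d := \row_i T i i.
have n10 : T o1 o1 - T o0 o0 != 0 by rewrite subr_eq0 dT.
have n20 : T o2 o2 - T o0 o0 != 0 by rewrite subr_eq0 dT.
have n21 : T o2 o2 - T o1 o1 != 0 by rewrite subr_eq0 dT.
pose u10 := T o1 o0 / (T o1 o1 - T o0 o0).
pose u21 := T o2 o1 / (T o2 o2 - T o1 o1).
pose u20 := (u21 * T o1 o0 + T o2 o0) / (T o2 o2 - T o0 o0).
exists (mx3 1 0 0 u10 1 0 u20 u21 1), d; split.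
- by rewrite mx3_det; ring.
- rewrite mx3_diag !mxE {1}(trig_mx3 TT) !mx3M /u20 /u21 /u10.
  by congr mx3; field; rewrite ?n10 ?n20 ?n21.
move=> i j; rewrite !mxE => E; apply/eqP/negPn/negP => /dT.
by rewrite E eqxx.
Qed.

Lemma regular_eigenbasis X Q : Q \in unitmx -> is_trig_mx (Ad Q X) ->
  (forall i j, i != j -> Ad Q X i i != Ad Q X j j) ->
  exists P d, eigenbasis X P d.
Proof.
move=> QU TX dX; have [U [d [U1 UT inj]]] := trig_eigenbasis TX dX.
exists (U *m Q), d; split=> //.
  by rewrite unitmx_mul QU andbT unitmxE U1 unitr1.
by rewrite mulmxA -UT /Ad -!mulmxA mulVmx // mulmx1.
Qed.

Definition gram P : 'M[C]_3 := P *m J R *m star P.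

Lemma star_diag d : star (diag_mx d) = diag_mx (map_mx conjc d).
Proof. by rewrite /star map_diag_mx tr_diag_mx. Qed.

Lemma gram_herm P i j : gram P j i = ((gram P i j)^*)%C.
Proof.
have {1}-> : gram P = star (gram P) by rewrite /gram !starM starK star_J mulmxA.
by rewrite !mxE.
Qed.

Lemma gram_mul S P : gram (S *m P) = S *m gram P *m star S.
Proof. by rewrite /gram starM !mulmxA. Qed.

Lemma det_gram P : \det (gram P) = - (\det P * ((\det P)^*)%C).
Proof.
rewrite /gram !det_mulmx det_star {1}mx3_J mx3_det.
by rewrite !(mulr0, mul0r, subr0, mul1r, mulr1, addr0) mulrN1 mulNr.
Qed.

(** [X] is skew for the form, so eigenvectors for [a] and [b] can only pair
    nontrivially when [a + b^* = 0]. *)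
Lemma gram_eigen X P d i j : X \in su R -> eigenbasis X P d ->
  (d 0 i + ((d 0 j)^*)%C) * gram P i j = 0.
Proof.
move=> /suE[Xs _] [_ PX _].
have XJ : (X : 'M[C]_3) *m J R + J R *m star X = 0.
  have := congr1 (fun Z : 'M[C]_3 => J R *m Z *m J R) Xs.
  rewrite mulmx0 mul0mx mulmxDr mulmxDl !mulmxA JJ mul1mx -mulmxA JJ mulmx1.
  by rewrite addrC.
have : diag_mx d *m gram P + gram P *m star (diag_mx d) = 0.
  rewrite /gram -!mulmxA -starM -PX starM !mulmxA -PX.
  by rewrite -mulmxDl -!mulmxA -mulmxDr XJ mulmx0 mul0mx.
move: (gram P) => K /matrixP/(_ i j).
by rewrite star_diag mul_diag_mx mul_mx_diag !mxE => <-; ring.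
Qed.

(** The eigenvalue of a partner of the row [i] is determined by that of [i], and
    eigenvalues are distinct. *)
Lemma gram_sparse X P d i j k : X \in su R -> eigenbasis X P d ->
  gram P i j != 0 -> j != k -> gram P i k = 0.
Proof.
move=> Xsu PX Kij jk; have [_ _ inj] := PX.
apply/eqP/negPn/negP => Kik; move/eqP: jk; apply; apply: inj.
have /eqP := gram_eigen i j Xsu PX; have /eqP := gram_eigen i k Xsu PX.
rewrite !mulf_eq0 (negPf Kij) (negPf Kik) !orbF !addr_eq0 => /eqP-> /eqP.
by move=> /oppr_inj/(can_inj (@conjcK R)).
Qed.

Lemma eigenbasis_perm X P d (s : {perm 'I_3}) : eigenbasis X P d ->
  eigenbasis X (row_perm s P) (\row_j d 0 (s j)).
Proof.
move=> [PU PX inj]; split.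
- by rewrite row_permE unitmx_mul unitmx_perm.
- apply/matrixP=> i j; rewrite row_permE -mulmxA PX -!row_permE.
  by rewrite !mul_diag_mx !mxE.
by move=> i j; rewrite !mxE => /inj/perm_inj.
Qed.

Lemma gram_perm P (s : {perm 'I_3}) i j : gram (row_perm s P) i j = gram P (s i) (s j).
Proof.
rewrite /gram !mxE; apply: eq_bigr => k _; rewrite !mxE; congr (_ * _).
by apply: eq_bigr => l _; rewrite !mxE.
Qed.

Lemma gram_real P i : exists k : R, gram P i i = k%:C%C.
Proof.
have := gram_herm P i i; case: (gram P i i) => x y [] /eqP.
by rewrite -addr_eq0 -mulr2n mulrn_eq0 /= => /eqP->; exists x.
Qed.

(** The form has signature (2, 1), so its determinant is negative in every basis. *)
Lemma det_gram_real P : P \in unitmx ->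
  exists2 r : R, r < 0 & \det (gram P) = r%:C%C.
Proof.
rewrite unitmxE unitfE det_gram; case: (\det P) => x y; rewrite eq_complex /= => xy.
exists (- (x ^+ 2 + y ^+ 2)); last first.
  by apply: complex_ext => /=; ring.
rewrite oppr_lt0 lt_neqAle addr_ge0 ?sqr_ge0 // andbT eq_sym.
by rewrite paddr_eq0 ?sqr_ge0 // !sqrf_eq0.
Qed.

End Diagonalisation.

Section NormalForm.
Variable R : realType.
Notation C := R[i].
Implicit Types (X : gl3 R) (P Q T K S : 'M[C]_3) (d : 'rV[C]_3).

(** With a zero diagonal, the Gram determinant is the sum of the two 3-cycle terms;
    each contains two entries of one row, up to conjugation, so it vanishes. *)
Lemma gram_anisotropic X P d : X \in su R -> eigenbasis X P d ->
  exists i, gram P i i != 0.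
Proof.
move=> Xsu PX; have [PU _ _] := PX.
have [r r0 Er] := det_gram_real PU.
have [|] := boolP [exists i, gram P i i != 0]; first by move/existsP.
rewrite negb_exists => /forallP K0.
have {}K0 i : gram P i i = 0 by apply/eqP; have := K0 i; rewrite negbK.
have sp i j k : j != k -> gram P i j * gram P i k = 0.
  move=> jk; have [->|Kij] := eqVneq (gram P i j) 0; first by rewrite mul0r.
  by rewrite (gram_sparse Xsu PX Kij jk) mulr0.
have E : gram P o0 o1 * gram P o1 o2 = 0 /\ gram P o0 o2 * gram P o1 o0 = 0.
  have := sp o1 o0 o2 isT; rewrite (gram_herm P o0 o1).
  have [->|K01] := eqVneq (gram P o0 o1) 0.
    by rewrite conjc0 mul0r mulr0.
  move=> /eqP; rewrite mulf_eq0 conjc_eq0 (negPf K01) /= => /eqP->.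
  rewrite mulr0; split=> //.
  have := sp o0 o1 o2 isT => /eqP; rewrite mulf_eq0 (negPf K01) /= => /eqP->.
  by rewrite mul0r.
have : \det (gram P) = 0.
  rewrite [gram P]mx3_eta mx3_det !K0; case: E => E1 E2.
  transitivity (gram P o0 o1 * gram P o1 o2 * gram P o2 o0
                + gram P o0 o2 * gram P o1 o0 * gram P o2 o1); first by ring.
  by rewrite E1 E2 !mul0r addr0.
by move/eqP; rewrite Er eq_complex /= eqxx andbT lt_eqF.
Qed.

(** The first basis vector has norm 1, so the form is not negative. *)
Lemma gram_not_negative P (k : 'I_3 -> R) :
  P \in unitmx -> gram P = diag_mx (\row_i (k i)%:C%C) ->
  exists i, 0 < k i.
Proof.
move=> PU PK; have [|] := boolP [exists i, 0 < k i]; first by move/existsP.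
rewrite negb_exists => /forallP k0; exfalso.
have : J R = gram (invmx P *m P) by rewrite mulVmx // /gram star1 mul1mx mulmx1.
rewrite gram_mul PK => /matrixP/(_ o0 o0).
rewrite mul_mx_diag mx3_J [in RHS]mxE sum3 !mxE /=.
have sq (i : 'I_3) (z : C) : complex.Re (z * (k i)%:C%C * (z^*)%C) <= 0.
  case: z => x y /=; have := k0 i; rewrite -leNgt => ki.
  have := sqr_ge0 x; have := sqr_ge0 y; nra.
move/(congr1 (@complex.Re R)); rewrite !raddfD /=.
move: (sq o0 (invmx P o0 o0)) (sq o1 (invmx P o0 o1)) (sq o2 (invmx P o0 o2)).
by lra.
Qed.

(** After a permutation the row 0 is anisotropic, hence orthogonal to the other two.
    These are either orthogonal, and then the sign of the determinant and
    [gram_not_negative] leave exactly one negative norm, or they span a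
    hyperbolic plane. *)
Lemma gram_normal_form X P d : X \in su R -> eigenbasis X P d ->
  exists P' d', eigenbasis X P' d' /\
   ((exists k0 k1 k2 : R, [/\ 0 < k0, 0 < k1, k2 < 0 &
      gram P' = mx3 (k0%:C)%C 0 0 0 (k1%:C)%C 0 0 0 (k2%:C)%C]) \/
    (exists (k0 : R) (q : C), [/\ 0 < k0, q != 0 &
      gram P' = mx3 (k0%:C)%C 0 0 0 0 q 0 (q^*)%C 0])).
Proof.
move=> Xsu PX; have [i Ki] := gram_anisotropic Xsu PX.
have := eigenbasis_perm (tperm o0 i) PX.
have := gram_perm P (tperm o0 i) o0 o0; rewrite !tpermL.
move: (row_perm _ P) (\row_j d 0 _) => {PX d} P' d E PX.
rewrite -{}E in Ki; move: P' Ki PX => {P i} P K00 PX.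
have [PU _ _] := PX; have [r r0 Er] := det_gram_real PU.
have K01 := gram_sparse Xsu PX K00 (isT : o0 != o1).
have K02 := gram_sparse Xsu PX K00 (isT : o0 != o2).
have K10 : gram P o1 o0 = 0 by rewrite gram_herm K01 conjc0.
have K20 : gram P o2 o0 = 0 by rewrite gram_herm K02 conjc0.
have [k0 E0] := gram_real P o0.
have [K12|K12] := eqVneq (gram P o1 o2) 0; last first.
  have K21 : gram P o2 o1 != 0 by rewrite gram_herm conjc_eq0.
  have K11 := gram_sparse Xsu PX K12 (isT : o2 != o1).
  have K22 := gram_sparse Xsu PX K21 (isT : o1 != o2).
  exists P, d; split=> //; right; exists k0, (gram P o1 o2).
  have EK : gram P = mx3 (k0%:C)%C 0 0 0 0 (gram P o1 o2) 0 ((gram P o1 o2)^*)%C 0.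
    by rewrite [LHS]mx3_eta K01 K02 K10 K20 K11 K22 E0 (gram_herm P o1 o2).
  split=> //; move: Er; rewrite EK mx3_det; case: (gram P o1 o2) => x y.
  move/eqP; rewrite eq_complex /= => /andP[/eqP Er _].
  rewrite ltNge; apply/negP => k0n.
  have := mulr_le0_ge0 k0n (addr_ge0 (sqr_ge0 x) (sqr_ge0 y)); lra.
have K21 : gram P o2 o1 = 0 by rewrite gram_herm K12 conjc0.
have [k1 E1] := gram_real P o1; have [k2 E2] := gram_real P o2.
pose k (i : 'I_3) := if i == o0 then k0 else if i == o1 then k1 else k2.
have EK : gram P = diag_mx (\row_i (k i)%:C%C).
  by rewrite [LHS]mx3_eta mx3_diag K01 K02 K10 K20 K12 K21 E0 E1 E2 !mxE.
have kr : k0 * k1 * k2 < 0.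
  move: Er; rewrite EK mx3_diag mx3_det !mxE /k /= => /eqP; rewrite eq_complex /=.
  by move=> /andP[/eqP Er _]; move: r0; rewrite -Er; lra.
have [j kj] : exists j, k j < 0 /\ forall i, i != j -> 0 < k i.
  have [i ki] := gram_not_negative PU EK.
  have k0n : k0 != 0 by apply: contraTneq kr => ->; rewrite !mul0r ltxx.
  have k1n : k1 != 0 by apply: contraTneq kr => ->; rewrite mulr0 mul0r ltxx.
  have k2n : k2 != 0 by apply: contraTneq kr => ->; rewrite mulr0 ltxx.
  have ex (l : 'I_3) : (k l < 0 /\ forall i, i != l -> 0 < k i) ->
    exists j, k j < 0 /\ forall i, i != j -> 0 < k i by exists l.
  have [p0|p0] := ltP 0 k0; have [p1|p1] := ltP 0 k1; have [p2|p2] := ltP 0 k2.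
  - by exfalso; have := mulr_gt0 (mulr_gt0 p0 p1) p2; lra.
  - apply: (ex o2); rewrite /k /= lt_neqAle k2n; split=> // l.
    by case: (ord3P l) => ->.
  - apply: (ex o1); rewrite /k /= lt_neqAle k1n; split=> // l.
    by case: (ord3P l) => ->.
  - by exfalso; have := mulr_ge0 (mulr_le0 p1 p2) (ltW p0); lra.
  - apply: (ex o0); rewrite /k /= lt_neqAle k0n; split=> // l.
    by case: (ord3P l) => ->.
  - by exfalso; have := mulr_ge0 (mulr_le0 p0 p2) (ltW p1); lra.
  - by exfalso; have := mulr_ge0 (mulr_le0 p0 p1) (ltW p2); lra.
  by exfalso; move: ki; rewrite /k; case: (ord3P i) => -> /=; lra.
pose s := tperm o2 j; have s2 : s o2 = j by apply: tpermL.
exists (row_perm s P), (\row_i d 0 (s i)); split; first exact: eigenbasis_perm.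
have [kj0 kjp] := kj.
left; exists (k (s o0)), (k (s o1)), (k (s o2)); split; last 1 first.
- transitivity (diag_mx (\row_i (k (s i))%:C%C)); last by rewrite mx3_diag !mxE.
  by apply/matrixP=> a b; rewrite gram_perm EK !mxE (inj_eq perm_inj).
- by apply: kjp; rewrite -s2 (inj_eq perm_inj).
- by apply: kjp; rewrite -s2 (inj_eq perm_inj).
by rewrite s2.
Qed.

End NormalForm.

(** * Eigenbases adapted to the Hermitian form *)

Section Final.
Variable R : realType.
Notation C := R[i].
Implicit Types (X Y Z : gl3 R) (P Q T K S U : 'M[C]_3) (d : 'rV[C]_3).
Implicit Types (h m : {vspace gl3 R}).

(** Used to bring a unitary determinant to 1 without changing the Gram matrix. *)
Definition phase (c : C) : 'M[C]_3 := mx3 c 0 0 0 1 0 0 0 1.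

Lemma gram_phase (c : C) : c * (c^*)%C = 1 -> phase c *m J R *m star (phase c) = J R.
Proof.
move=> c1; rewrite /phase mx3_star mx3_J !mx3M !conjc0 !conjc1.
congr mx3; try ring.
by rewrite !(mulr1, mulr0, mul0r, addr0).
Qed.

(** If [S P] and [U] have the same Gram matrix, then [U^-1 S P] preserves the form.
    It conjugates [X] to [U^-1 D U]. The determinant is then corrected by a phase
    on the first row. *)
Lemma scale_to_SU (s0 s1 s2 : C) U X P d :
  let S := mx3 s0 0 0 0 s1 0 0 0 s2 in
  U \in unitmx -> (forall c, U *m phase c = phase c *m U) ->
  eigenbasis X P d -> S *m gram P *m star S = gram U ->
  exists g, SU g /\ U *m g *m (X : 'M[C]_3) = diag_mx d *m (U *m g).
Proof.
move=> S UU Uph [PU PX _] SK.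
pose V := invmx U *m (S *m P).
have UV : U *m V = S *m P by rewrite /V mulKVmx.
have SD : S *m diag_mx d = diag_mx d *m S.
  by rewrite /S mx3_diag !mx3M; congr mx3; ring.
have VX : U *m V *m (X : 'M[C]_3) = diag_mx d *m (U *m V).
  by rewrite UV -(mulmxA S) PX mulmxA SD -mulmxA.
have VJ : gram V = J R.
  by rewrite /V gram_mul gram_mul SK -gram_mul mulVmx // /gram mul1mx star1 mulmx1.
have u1 : \det V * ((\det V)^*)%C = 1.
  have := det_gram V; rewrite VJ {1}mx3_J mx3_det => E.
  by apply: oppr_inj; rewrite -E; ring.
pose c := ((\det V)^*)%C; have c1 : c * (c^*)%C = 1 by rewrite /c conjcK mulrC.
exists (phase c *m V); split.
  apply: SU_of_gram; first by rewrite -/(gram _) gram_mul VJ gram_phase.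
  by rewrite det_mulmx mx3_det -[RHS]c1 /c conjcK; ring.
have cD : phase c *m diag_mx d = diag_mx d *m phase c.
  by rewrite /phase mx3_diag !mx3M; congr mx3; ring.
have UcV : U *m (phase c *m V) = phase c *m (U *m V).
  by rewrite mulmxA Uph -mulmxA.
rewrite UcV; move: (phase c) (U *m V) cD VX => F B cD VX.
by rewrite -(mulmxA F) VX mulmxA cD -mulmxA.
Qed.

(** Its rows are eigenvectors of [e 8] and of the split Cartan subalgebra
    [h20 0 0 0]; the last two are isotropic. *)
Definition split_frame : 'M[C]_3 := mx3 1 0 0 0 1 'i%C 0 1 (- 'i%C).

Lemma split_frame_unit : split_frame \in unitmx.
Proof.
rewrite unitmxE unitfE mx3_det; apply/eqP => /eqP; rewrite eq_complex /=.
by move=> /andP[_ /eqP]; lra.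
Qed.

Lemma gram_split_frame : gram split_frame = mx3 1 0 0 0 0 2 0 2 0.
Proof.
rewrite /gram /split_frame mx3_star mx3_J !mx3M.
by congr mx3; apply: complex_ext => /=; ring.
Qed.

Lemma sqrt_scale (k : R) : 0 < k ->
  ((Num.sqrt k)^-1)%:C%C * k%:C%C * (((Num.sqrt k)^-1)%:C^*)%C = 1.
Proof.
move=> k0; rewrite conjc_real -!rmorphM /= -{2}(sqr_sqrtr (ltW k0)).
by rewrite mulrAC -expr2 exprVn mulVf ?rmorph1 // sqrf_eq0 gt_eqF // sqrtr_gt0.
Qed.

(** The two shapes of the Gram matrix give the two Cartan subalgebras: an
    orthogonal eigenbasis the compact one, a hyperbolic plane the split one. *)
Lemma diagonal_form X P d : X \in su R -> eigenbasis X P d ->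
  exists g d', [/\ SU g, injective (d' 0) &
    g *m (X : 'M[C]_3) = diag_mx d' *m g \/
    split_frame *m g *m (X : 'M[C]_3) = diag_mx d' *m (split_frame *m g)].
Proof.
move=> Xsu /(gram_normal_form Xsu)[P' [d' [PX [[k0 [k1 [k2 [k0p k1p k2n E]]]]|]]]].
  have k2p : 0 < - k2 by rewrite oppr_gt0.
  have [] := @scale_to_SU ((Num.sqrt k0)^-1)%:C%C ((Num.sqrt k1)^-1)%:C%C
    ((Num.sqrt (- k2))^-1)%:C%C 1%:M X P' d' (unitmx1 _ _) _ PX.
  - by move=> c; rewrite mul1mx mulmx1.
  - rewrite E /gram star1 mulmx1 mul1mx mx3_star mx3_J !mx3M !conjc0.
    congr mx3; try ring.
    + by rewrite -[RHS](sqrt_scale k0p); ring.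
    + by rewrite -[RHS](sqrt_scale k1p); ring.
    by rewrite -(sqrt_scale k2p) (rmorphN (real_complex R)); ring.
  move=> g [gSU]; rewrite mul1mx => gX; exists g, d'; case: PX => _ _ inj.
  by split; [exact: gSU | exact: inj | left].
move=> [k0 [q [k0p q0 E]]].
(* The factor 2 / q turns the pairing q into 2, that of the isotropic rows of
   [split_frame]. *)
have [] := @scale_to_SU ((Num.sqrt k0)^-1)%:C%C (2 / q) 1
  split_frame X P' d' split_frame_unit _ PX.
- by move=> c; rewrite /split_frame /phase !mx3M; congr mx3; ring.
- have qc : (q^*)%C != 0 by rewrite conjc_eq0.
  have cq : ((2 / q)^*)%C = 2 / (q^*)%C.
    by rewrite (rmorphM conjc) (fmorphV conjc); congr (_ / _); apply: conjc_nat.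
  rewrite E gram_split_frame mx3_star !mx3M !conjc0 conjc1 cq.
  congr mx3; try ring; try by field.
  by rewrite -[RHS](sqrt_scale k0p); ring.
move=> g [gSU gX]; exists g, d'; case: PX => _ _ inj.
by split; [exact: gSU | exact: inj | right].
Qed.

End Final.

(** * Classification *)

Section Classification.
Variable R : realType.
Notation C := R[i].
Implicit Types (X Y Z H : gl3 R) (B U M g : 'M[C]_3) (d : 'rV[C]_3).
Implicit Types (h m : {vspace gl3 R}).

Lemma commute_diag d M : injective (d 0) ->
  diag_mx d *m M = M *m diag_mx d -> M = diag_mx (\row_i M i i).
Proof.
move=> inj; rewrite mul_diag_mx mul_mx_diag => /matrixP dM.
apply/matrixP=> i j; have := dM i j; rewrite !mxE.
have [->//|ij] := eqVneq i j; rewrite mulrC => /eqP.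
rewrite -subr_eq0 -mulrBr mulf_eq0 subr_eq0 (inj_eq inj) (negPf ij) orbF.
by move=> /eqP->.
Qed.

Lemma commute_codiagonal B d X Y : B \in unitmx -> injective (d 0) ->
  B *m X = diag_mx d *m B -> X *m Y = Y *m X ->
  exists y, B *m (Y : 'M[C]_3) = diag_mx y *m B.
Proof.
move=> BU inj BX XY; pose M := B *m Y *m invmx B.
have MB : M *m B = B *m Y by rewrite /M mulmxKV.
exists (\row_i M i i); rewrite -(commute_diag inj) ?MB //.
apply: (can_inj (mulmxK BU)); rewrite -mulmxA MB mulmxA -BX -mulmxA XY.
by rewrite -[RHS]mulmxA -BX [RHS]mulmxA MB -mulmxA.
Qed.

Lemma diag_h12 (y : 'rV[C]_3) Z : Z \in su R -> Z = diag_mx y -> Z \in h12 R.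
Proof.
move=> /suP[l1 [l2 [l3 [l4 [l5 [l6 [l7 [l8 ->]]]]]]]].
rewrite su_mxE mx3_diag => /mx3_inj[[_ [E2 E3] [E4 E5]] [[_ _ [E7 E8]] _]].
apply/h12P; exists l1, l6; rewrite -su_mxE.
by congr su_mx; apply: oppr_inj; rewrite ?oppr0 // ?E4 ?E5 ?E7 ?E8 oppr0.
Qed.

Lemma diag_h20 (y : 'rV[C]_3) Z : Z \in su R ->
  split_frame R *m Z = diag_mx y *m split_frame R -> Z \in h20 0 0 0.
Proof.
move=> /suP[l1 [l2 [l3 [l4 [l5 [l6 [l7 [l8 ->]]]]]]]].
rewrite su_mxE mx3_diag /split_frame !mx3M.
move: (y 0 o0) (y 0 o1) (y 0 o2) => [a a'] [b b'] [c c'].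
case/mx3_inj=> -[E1 E2 E3] [[E4 E5 E6] [E7 E8 E9]].
move: E1 E2 E3 E4 E5 E6 E7 E8 E9.
do 9![move/eqP; rewrite eq_complex /= => /andP[/eqP ? /eqP ?]].
by rewrite -su_mxE; apply/h20_0P; exists l1, l8; congr su_mx; lra.
Qed.

(** Two complements of the same subspace coincide as soon as they are comparable. *)
Lemma complement_unique V h m m' :
  complementary V m h -> complementary V m' h -> (m <= m')%VS -> m' = m.
Proof.
move=> /complementaryP[mh _] /complementaryP[mh' mh0] mm'.
apply/eqP; rewrite eqEsubv mm' andbT; apply/subvP=> X Xm'.
have : X \in (m + h)%VS by rewrite mh -mh'; apply: subvP Xm'; apply: addvSl.
move=> /memv_addP[u um [v vh E]]; suff v0 : v = 0 by rewrite E v0 addr0.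
apply: mh0 => //; rewrite (_ : v = X - u); last by rewrite E addrC addKr.
by apply: memvB => //; apply: (subvP mm').
Qed.

(** [h] is abelian, so bracketing with it kills the [h]-component. *)
Lemma bracket_in_complement h m H Z :
  admissible h m -> H \in h -> Z \in su R -> lie H Z \in m.
Proof.
move=> [red dimh _] Hh; case: (red) => _ /complementaryP[<- _] hm.
move=> /memv_addP[u um [v vh ->]].
by rewrite (lieDr u v H) (reductive_abelian red dimh Hh vh) addr0; apply: hm.
Qed.

(** Every root vector is a bracket with an element of the Cartan subalgebra, so it
    lies in each reductive complement. *)
Lemma complement_h12 m : admissible (h12 R) m -> m = m12 R.
Proof.
move=> gm; case: (gm) (admissible12 R) => -[_ cm _] _ _ [[_ cm12 _] _ _].
apply: complement_unique cm12 cm _; apply/subvP=> X.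
move=> /m12P[l2 [l3 [l4 [l5 [l7 [l8 ->]]]]]].
pose Z1 : gl3 R := su_mx 0 (- l3 / 2) (l2 / 2) (- l5) l4 0 0 0.
pose Z6 : gl3 R := su_mx 0 0 0 0 0 0 (l8 / 2) (- l7 / 2).
pose H1 : gl3 R := su_mx 1 0 0 0 0 0 0 0.
pose H6 : gl3 R := su_mx 0 0 0 0 0 1 0 0.
rewrite (_ : su_mx _ _ _ _ _ _ _ _ = lie H1 Z1 + lie H6 Z6); last first.
  by rewrite !lie_su su_mxD; congr su_mx; field.
apply: memvD; apply: (bracket_in_complement gm).
- by apply/h12P; do 2!eexists.
- by apply/suP; do 8!eexists.
- by apply/h12P; do 2!eexists.
by apply/suP; do 8!eexists.
Qed.

Lemma complement_h20 m : admissible (h20 (0 : R) 0 0) m -> m = m20 0 0 0.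
Proof.
move=> gm; case: (gm) (admissible20_0 R) => -[_ cm _] _ _ [[_ cm20 _] _ _].
apply: complement_unique cm20 cm _; apply/subvP=> X.
move=> /m20_0P[l2 [l3 [l4 [l5 [l6 [l7 ->]]]]]].
pose Z1 : gl3 R :=
  su_mx 0 (- 2 / 3 * l3) (2 / 3 * l2) (- 2 / 3 * l5) (2 / 3 * l4) 0 0 0.
pose Z8 : gl3 R := su_mx 0 0 0 0 0 (l7 / 2) (l6 / 2) 0.
pose H1 : gl3 R := su_mx 1 0 0 0 0 (- 1 / 2) 0 0.
pose H8 : gl3 R := su_mx 0 0 0 0 0 (- 0 / 2) 0 1.
rewrite (_ : su_mx _ _ _ _ _ _ _ _ = lie H1 Z1 + lie H8 Z8); last first.
  by rewrite !lie_su su_mxD; congr su_mx; field.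
apply: memvD; apply: (bracket_in_complement gm).
- by apply/h20_0P; exists 1, 0.
- by apply/suP; do 8!eexists.
- by apply/h20_0P; exists 0, 1.
by apply/suP; do 8!eexists.
Qed.

Lemma classification h m : admissible h m ->
  conjugate_pair h m (h12 R) (m12 R) \/
  conjugate_pair h m (h20 0 0 0) (m20 0 0 0).
Proof.
move=> gm; case: (gm) => red dimh _; case: (red) => -[/subvP hs _] _ _.
have [X [Q [Xh QU TX dX]]] := regular_element red dimh.
have [P [d PX]] := regular_eigenbasis QU TX dX.
have [g [d' [gSU inj gX]]] := diagonal_form (hs _ Xh) PX.
have gU := SU_unit gSU.
have XY Y : Y \in h -> X *m Y = Y *m X.
  by move=> Yh; apply/eqP; rewrite -subr_eq0; apply/eqP/(reductive_abelian red dimh).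
have cg : conjugate_pair h m (linfun (Ad g) @: h) (linfun (Ad g) @: m) by exists g.
have gm' := admissible_conjugate cg gm; have [_ dimh' _] := gm'.
have img H : H \in (linfun (Ad g) @: h)%VS ->
    [/\ Ad (invmx g) H \in h, H \in su R & g *m Ad (invmx g) H = H *m g].
  rewrite (mem_Ad _ _ gU) => Hh; split=> //.
    by rewrite -(AdKV H gU); apply: Ad_su => //; apply: hs.
  by rewrite -[in RHS](AdKV H gU) /(Ad g) (mulmxKV gU).
case: gX => gX; [left | right].
- have E : (linfun (Ad g) @: h)%VS = h12 R.
    apply/eqP; rewrite eqEdim dimh' dim_span andbT; apply/subvP=> H.
    move=> /img[Yh Hsu gY]; have [y] := commute_codiagonal gU inj gX (XY _ Yh).
    by rewrite gY => /(can_inj (mulmxK gU)); apply: diag_h12.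
  by move: cg gm'; rewrite E => cg /complement_h12 E'; rewrite -E'.
have E : (linfun (Ad g) @: h)%VS = h20 0 0 0.
  apply/eqP; rewrite eqEdim dimh' dim_span andbT; apply/subvP=> H.
  move=> /img[Yh Hsu gY].
  have WgU : split_frame R *m g \in unitmx by rewrite unitmx_mul split_frame_unit.
  have [y] := commute_codiagonal WgU inj gX (XY _ Yh).
  rewrite -(mulmxA (split_frame R)) gY !mulmxA => /(can_inj (mulmxK gU)).
  exact: diag_h20.
by move: cg gm'; rewrite E => cg /complement_h20 E'; rewrite -E'.
Qed.

End Classification.

Theorem proposition11 (R : realType) (h m : {vspace gl3 R}) :
  [/\ reductive (su R) h m, \dim h = 2%N & generates (su R) m] <->
  (conjugate_pair h m (h12 R) (m12 R) \/
   exists a b c : R, conjugate_pair h m (h20 a b c) (m20 a b c)).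
Proof.
split=> [/classification[]|[|[a [b [c]]]]].
- by left.
- by right; exists 0, 0, 0.
- by move/conjugate_pair_sym/admissible_conjugate; apply; apply: admissible12.
move/conjugate_pair_sym/admissible_conjugate; apply.
exact: admissible_conjugate (h20_conjugate a b c) (admissible20_0 R).
Qed.
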